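(* Let $S=\mathbb{C}^2$ with the action of $\mathsf{T}_0=\{(t_1,t_2):t_1t_2=1\}$, $E=\bigoplus_{i=1}^N\mathcal{O}_S\langle y_i\rangle$ and $\alpha\in K_{\mathsf{T}}(S)$. We have the following correspondence in degree $-1$: $$\mathcal{S}^{\mathrm{red}}_{-1}(E,\alpha;q)=\mathcal{V}^{\mathrm{red}}_{-1}(E,\alpha;(-1)^Nq).$$ When $\alpha=V=\bigoplus_{i=1}^r\mathcal{O}_S\langle v_i\rangle$ is an equivariant vector bundle of rank $r$, we have the following symmetry: $$\mathcal{S}^{\mathrm{red}}_{-1}(E,V;(-1)^Nq)=\mathcal{S}^{\mathrm{red}}_{-1}(V,E;(-1)^rq).$$
   Context: Setup. $\mathsf{T}=\mathsf{T}_0\times\mathsf{T}_1\times\mathsf{T}_2$, where $\mathsf{T}_0=\{(t_1,t_2)\in(\mathbb{C}^* )^2:t_1t_2=1\}$ acts on $S=\mathbb{C}^2$ with tangent weights $t_1,t_2$ at the origin, and $\mathsf{T}_1,\mathsf{T}_2$ are tori with coordinates $y_i,v_i$ acting trivially on $S$. Equivariant first Chern classes: $c_1(t_1)=\lambda=-c_1(t_2)$, $c_1(y_i)=m_i$, $c_1(v_i)=w_i$; weights are identified with their Chern characters ($t_1=e^{\lambda}$, etc.). $\mathcal{O}_S\langle\chi\rangle$ is the trivial line bundle with character $\chi$; $\alpha=[\bigoplus_{i\le a}\mathcal{O}_S\langle v_i\rangle]-[\bigoplus_{a<i\le a+b}\mathcal{O}_S\langle v_i\rangle]$ with $v_i$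 generic parameters. Reduced invariants. The $\mathsf{T}$-fixed points $Z_\pi$ of $\operatorname{Quot}_S(E,n)$ (zero-dimensional length $n$ quotients of $E$) are indexed by $N$-tuples of partitions $\pi=(\pi^{(1)},\dots,\pi^{(N)})$ of total size $|\pi|=n$. With boxes $\{(i,j)\in\mathbb{Z}_{\ge0}^2:j<\rho_{i+1}\}$ for a partition $\rho$ and $Q_k=\sum_{(i,j)\in\pi^{(k)}}t_1^{-j}t_2^{-i}$: $T^{\mathrm{vir}}_{Z_\pi}=\sum_{k,l}(Q_l-(1-t_1)(1-t_2)\overline{Q_k}Q_l)y_k^{-1}y_l$ (bar inverts $t_1,t_2$), $T^{\mathrm{red}}_{Z_\pi}=T^{\mathrm{vir}}_{Z_\pi}+1$ (modulo $t_1t_2=1$), $\alpha^{[n]}|_{Z_\pi}=\sum_k(\sum_{i\le a}v_i-\sum_{i>a}v_i)y_kQ_k$. For a virtual character $\gamma=\sum n_\chi\chi$: $e(\gamma)=\prod c_1(\chi)^{n_\chi}$, $s(\gamma)=\prod(1+c_1(\chi))^{-n_\chi}$, $\det\gamma=\prod\chi^{n_\chi}$, $\operatorname{ch}(\Lambda_{-1}\gamma^\vee)=\prod(1-\chi^{-1})^{n_\chi}$. Then $$\mathcal{S}^{\mathrm{red}}(E,\alpha;q)=\sum_{|\pi|>0}q^{|\pi|}\frac{s(\alpha^{[n]}|_{Z_\pi})}{e(T^{\mathrm{red}}_{Z_\pi})},\qquad\mathcal{V}^{\mathrm{red}}(E,\alpha;q)=\sum_{|\pi|>0}q^{|\pi|}\frac{\operatorname{ch}(\det\alpha^{[n]}|_{Z_\pi})}{\operatorname{ch}(\Lambda_{-1}(T^{\mathrm{red}}_{Z_\pi})^\vee)},$$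 where a fixed point at which $T^{\mathrm{red}}$ has the trivial weight with negative multiplicity contributes $0$. $\mathcal{S}^{\mathrm{red}}(V,E;q)$ is defined in the same way with the roles of $E$ (weights $y_i$) and $V$ (weights $v_i$) exchanged. The subscript $-1$ denotes the part of total degree $-1$ in $(\lambda,\vec m,\vec w)$: the coefficient of $b^{-1}$ in the Laurent expansion in $b$ after scaling all these variables by $b$. *)

(* Defs.v *)
From HB Require Import structures.
From mathcomp Require Import all_boot all_order all_algebra.
From mathcomp Require Import fraction freeg mpoly.

Set Implicit Arguments.
Unset Strict Implicit.
Unset Printing Implicit Defensive.

Import Order.TTheory GRing.Theory Num.Theory.
Local Open Scope ring_scope.

(** ** Formal power series and Laurent series with coefficients in a field *)

Section Series.
Context (K : fieldType).

(* [f : fps K] stands for \sum_n f n * x^n. *)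
Definition fps := nat -> K.

Definition fps_const (c : K) : fps := fun n => if n == 0%N then c else 0.

Definition fps_lin (c d : K) : fps :=
  fun n => if n == 0%N then c else if n == 1%N then d else 0.

Definition fps_mul (f g : fps) : fps :=
  fun n => \sum_(i < n.+1) f i * g (n - i)%N.

(* The first [n] coefficients of 1/f: the recursion is
   f_0 g_n = [n = 0] - \sum_(i < n) f_(n - i) g_i, and f_0 must be nonzero. *)
Fixpoint fps_inv_seq (f : fps) (n : nat) : seq K :=
  if n is m.+1 then
    let g := fps_inv_seq f m in
    rcons g (((m == 0%N)%:R - \sum_(i < m) f (m - i)%N * g`_i) / f 0%N)
  else [::].

Definition fps_inv (f : fps) : fps := fun n => (fps_inv_seq f n.+1)`_n.

Definition fps_exp (c : K) : fps := fun n => c ^+ n / n`!%:R.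

(* The substitution x := c * x. *)
Definition fps_scale (c : K) (f : fps) : fps := fun n => c ^+ n * f n.

(* [Laurent v f] is b^v * \sum_k f k * b^k.  The coefficient [f 0] may vanish,
   but it must not when the series is inverted. *)
Record laurent := Laurent { lval : int; lser : fps }.

Definition lcoef (x : laurent) (d : int) : K :=
  if d - lval x is Posz k then lser x k else 0.

Definition lone : laurent := Laurent 0 (fps_const 1).

Definition lmul (x y : laurent) : laurent :=
  Laurent (lval x + lval y) (fps_mul (lser x) (lser y)).

Definition linv (x : laurent) : laurent :=
  Laurent (- lval x) (fps_inv (lser x)).

Definition lpow (x : laurent) (n : nat) : laurent := iter n (lmul x) lone.

Definition lpowz (x : laurent) (n : int) : laurent :=
  match n with Posz m => lpow x m | Negz m => linv (lpow x m.+1) end.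

(* c * b *)
Definition l_lin (c : K) : laurent := Laurent 1 (fps_const c).

(* 1 + c * b *)
Definition l_one_plus (c : K) : laurent := Laurent 0 (fps_lin 1 c).

(* exp (c * b) *)
Definition l_exp (c : K) : laurent := Laurent 0 (fps_exp c).

(* 1 - exp (- c * b): the constant term vanishes, so a factor b is taken out;
   the remaining power series starts with c. *)
Definition l_one_minus_expN (c : K) : laurent :=
  Laurent 1 (fun n => - fps_exp (- c) n.+1).

End Series.

(** ** Virtual characters of a torus with (additive) character lattice X *)

Section VirtualCharacters.
Context (X : zmodType).

(* The representation ring of the torus, additively: <<x>> is the character x,
   and the product of characters is the addition of X. *)
Definition vchar := {freeg X / int}.

Implicit Types g h : vchar.

Definition vmul g h : vchar :=
  \sum_(x <- dom g) \sum_(y <- dom h) << coeff x g * coeff y h *g x + y >>.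

Definition vbar g : vchar := \sum_(x <- dom g) << coeff x g *g - x >>.

Definition vdet g : X := \sum_(x <- dom g) x *~ coeff x g.

(* Characteristic classes, with every first Chern class scaled by b. *)
Context (K : fieldType) (c1 : X -> K).

Definition euler g : laurent K :=
  \big[@lmul K/lone K]_(x <- dom g) lpowz (l_lin (c1 x)) (coeff x g).

Definition segre g : laurent K :=
  \big[@lmul K/lone K]_(x <- dom g) lpowz (l_one_plus (c1 x)) (- coeff x g).

Definition ch_det g : laurent K := l_exp (c1 (vdet g)).

(* ch (Lambda_{-1} g^\vee) *)
Definition ch_Lambda_dual g : laurent K :=
  \big[@lmul K/lone K]_(x <- dom g) lpowz (l_one_minus_expN (c1 x)) (coeff x g).

End VirtualCharacters.

(** ** Fixed points of the Quot scheme *)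

(* Partitions of size at most n, padded with zeros to length n. *)
Definition is_partition (n : nat) (rho : {ffun 'I_n -> 'I_n.+1}) : bool :=
  [forall i : 'I_n, forall j : 'I_n, (i <= j)%N ==> (rho j <= rho i)%N].

Definition part_tuple (N n : nat) := {ffun 'I_N -> {ffun 'I_n -> 'I_n.+1}}.

(* N-tuples of partitions of total size n *)
Definition is_fixed_point (N n : nat) (pi : part_tuple N n) : bool :=
  [forall k, is_partition (pi k)]
  && (\sum_(k < N) \sum_(i < n) pi k i == n :> nat)%N.

Section FixedPoints.
(* [t1], [t2] are the tangent weights (with t1 + t2 = 0 in additive notation
   in the intended use), [y] the weights of the framing bundle. *)
Context (X : zmodType) (t1 t2 : X) (N : nat) (y : 'I_N -> X).
Context (n : nat).

Definition Qchar (rho : {ffun 'I_n -> 'I_n.+1}) : vchar X :=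
  \sum_(i < n) \sum_(j < rho i) << - (t1 *+ j) - (t2 *+ i) >>.

(* (1 - t1) (1 - t2) *)
Definition koszul : vchar X := vmul (<< 0 >> - << t1 >>) (<< 0 >> - << t2 >>).

Definition Tvir (pi : part_tuple N n) : vchar X :=
  \sum_(k < N) \sum_(l < N)
    vmul (Qchar (pi l)
          - vmul koszul (vmul (vbar (Qchar (pi k))) (Qchar (pi l))))
         << - y k + y l >>.

Definition Tred (pi : part_tuple N n) : vchar X := Tvir pi + << 0 >>.

Definition taut (alpha : vchar X) (pi : part_tuple N n) : vchar X :=
  \sum_(k < N) vmul (vmul alpha << y k >>) (Qchar (pi k)).

End FixedPoints.

(** ** Reduced Segre and Verlinde series: parts of degree d *)

(* A fixed point at which [Tred] has the trivial weight with negative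
   multiplicity contributes 0; the trivial weight never occurs in [Tred] with
   positive multiplicity when t1 + t2 = 0, so only classes of nontrivial
   weights get inverted. *)
Section Reduced.
Context (X : zmodType) (K : fieldType) (c1 : X -> K).
Context (t1 t2 : X) (N : nat) (y : 'I_N -> X) (alpha : vchar X) (d : int).

Definition segre_red : fps K := fun n =>
  if n == 0%N then 0 else
  \sum_(pi : part_tuple N n | is_fixed_point pi)
    let T := Tred t1 t2 y pi in
    if coeff 0 T < 0 then 0 else
    lcoef (lmul (segre c1 (taut t1 t2 y alpha pi)) (linv (euler c1 T))) d.

Definition verlinde_red : fps K := fun n =>
  if n == 0%N then 0 else
  \sum_(pi : part_tuple N n | is_fixed_point pi)
    let T := Tred t1 t2 y pi in
    if coeff 0 T < 0 then 0 else
    lcoef (lmul (ch_det c1 (taut t1 t2 y alpha pi))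
                (linv (ch_Lambda_dual c1 T))) d.

End Reduced.

(** ** The torus T = T0 x T1 x T2 *)

(* Coordinates on the character lattice: the exponent of t1 (t2 = t1^-1 on T0),
   then those of the N characters y_i, then those of the r characters v_j. *)
Section Torus.
Context (N r : nat).

Definition torus_char := 'rV[int]_(1 + N + r).

Definition wt_t1 : torus_char := delta_mx 0 (lshift r (lshift N ord0)).
Definition wt_t2 : torus_char := - wt_t1.
Definition wt_y (i : 'I_N) : torus_char := delta_mx 0 (lshift r (rshift 1 i)).
Definition wt_v (j : 'I_r) : torus_char := delta_mx 0 (rshift (1 + N) j).

(* The field Q(lambda, m_1, ..., m_N, w_1, ..., w_r). *)
Definition eq_field := {fraction {mpoly rat[1 + N + r]}}.

(* The variables 'X_i are, in this order, lambda, the m_i and the w_j. *)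
Definition chern1 (x : torus_char) : eq_field :=
  \sum_(i < 1 + N + r) tofrac 'X_i *~ x 0 i.

End Torus.

(* [V_1 + ... + V_a] - [V_(a+1) + ... + V_(a+b)] *)
Definition alpha_class (N a b : nat) : vchar (torus_char N (a + b)) :=
  \sum_(i < a) << wt_v N (lshift b i) >> - \sum_(i < b) << wt_v N (rshift a i) >>.

Definition E_class (N r : nat) : vchar (torus_char N r) :=
  \sum_(i < N) << wt_y r i >>.

Definition V_class (N r : nat) : vchar (torus_char N r) :=
  \sum_(j < r) << wt_v N j >>.

(* Degree d parts of S^red(E, alpha), V^red(E, alpha) and S^red(V, alpha). *)
Definition SredE (N r : nat) (alpha : vchar (torus_char N r)) (d : int) :=
  segre_red (@chern1 N r) (wt_t1 N r) (wt_t2 N r) (@wt_y N r) alpha d.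

Definition VredE (N r : nat) (alpha : vchar (torus_char N r)) (d : int) :=
  verlinde_red (@chern1 N r) (wt_t1 N r) (wt_t2 N r) (@wt_y N r) alpha d.

Definition SredV (N r : nat) (alpha : vchar (torus_char N r)) (d : int) :=
  segre_red (@chern1 N r) (wt_t1 N r) (wt_t2 N r) (@wt_v N r) alpha d.

(* Main.v *)
Require Import Defs.
From HB Require Import structures.
From mathcomp Require Import all_boot all_order all_algebra.
From mathcomp Require Import fraction freeg mpoly.
From mathcomp Require Import boolp ring zify.
Import Order.TTheory GRing.Theory Num.Theory.
Local Open Scope ring_scope.

Set Implicit Arguments.
Unset Strict Implicit.
Unset Printing Implicit Defensive.

(** Both series are computed in closed form; the theorem is read off from the
two formulas.

Vanishing.  When t1 t2 = 1, the class (1 - t1) (1 - t2) is a norm: with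
U = (1 - t1) Q the quadratic part of the tangent space of a partition is the
product of U and its conjugate.  Its constant coefficient is the sum of the
squares of the coefficients of U, and this is at least twice the number of
diagonal boxes ([coeff0_norm_Qchar]).  Hence the trivial weight has
multiplicity at most 1 - (number of diagonal boxes) in T^red, and the only
fixed points that contribute have one diagonal box in all: a hook of leg
length l in one slot k, all other slots being empty ([is_hook]).  For a hook
the product (1 - t1) Q telescopes to a difference of two characters, and with
w_(k,l) = y_k t1^l and s = (k, l) one finds ([Tred_hook])
  T^red = t1^n + t1^(-n) + sum over s' <> s of w_s / w_s'.

Residues.  Let z_s be the first Chern class of w_s.  Up to the factor
-(n lambda)^(-2), the hook s contributes P (z_s) / prod_(s' <> s) (z_s - z_s'),
where P (x) is the coefficient of b^(Nn) in a product of power series in the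
variables b (x + shift); so P is a polynomial of degree at most the number N n
of hooks.  The total is the sum of all the residues of
P (x) / prod_s (x - z_s), and it depends only on the two top coefficients of P
([residue_sum]).  For any product of this shape these two coefficients give
([residue_series]) a factor made of weights only times the coefficient of
b^(Nn) in f^rho g^(Nn) (b f' / f).  Here rho is n times the rank of alpha, f is
the series attached to the weights of alpha and g the one attached to the
weights of T^red: f = 1 / (1 + b) and g = 1 for Segre, f = exp b and
g = b / (1 - exp (- b)) for Verlinde.  The factor made of weights is common to
both ([segre_red_closed], [verlinde_red_closed]).

Comparison.  The remaining one-variable coefficients obey the same recursion up
to a sign ([segre_coefS], [verlinde_coefS]), whence the correspondence.  The
Segre coefficient is a signed binomial coefficient
C (Nn + rn - 1, Nn - 1) when alpha = V ([segre_coef_fact]); multiplied by r this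
binomial coefficient is symmetric under the exchange of N and r, whence the
symmetry. *)

(** * The ring of formal power series *)

(** A synonym of the type of coefficient sequences, which carries the ring
structure given by the Cauchy product. *)
Definition ps (R : Type) := nat -> R.
HB.instance Definition _ (R : Type) := gen_eqMixin (ps R).
HB.instance Definition _ (R : Type) := gen_choiceMixin (ps R).

Section PowerSeriesRing.
Context (R : comNzRingType).
Implicit Types f g h : ps R.

(** Products of truncations have the right coefficients in low degree, so the
ring laws of [ps] are inherited from those of polynomials. *)
Definition ps_trunc n f : {poly R} := \poly_(i < n.+1) f i.

Definition ps_zero : ps R := fun=> 0.
Definition ps_one : ps R := fun n => if n == 0%N then 1 else 0.
Definition ps_add f g : ps R := fun n => f n + g n.
Definition ps_opp f : ps R := fun n => - f n.
Definition ps_mul f g : ps R := fun n => \sum_(i < n.+1) f i * g (n - i)%N.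

Lemma ps_addA : associative ps_add.
Proof. by move=> f g h; apply/funext => n; apply: addrA. Qed.
Lemma ps_addC : commutative ps_add.
Proof. by move=> f g; apply/funext => n; apply: addrC. Qed.
Lemma ps_add0 : left_id ps_zero ps_add.
Proof. by move=> f; apply/funext => n; apply: add0r. Qed.
Lemma ps_addN : left_inverse ps_zero ps_opp ps_add.
Proof. by move=> f; apply/funext => n; apply: addNr. Qed.

HB.instance Definition _ :=
  GRing.isZmodule.Build (ps R) ps_addA ps_addC ps_add0 ps_addN.

Lemma coef_trunc_mul f g n m : (m <= n)%N ->
  (ps_trunc n f * ps_trunc n g)`_m = ps_mul f g m.
Proof.
move=> le_mn; rewrite coefM; apply: eq_bigr => i _.
by rewrite !coef_poly !ltnS (leq_trans (leq_subr _ _)) // (leq_trans (leq_ord i)).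
Qed.

Lemma ps_mulC : commutative ps_mul.
Proof.
by move=> f g; apply/funext => n; rewrite -!(@coef_trunc_mul _ _ n) // mulrC.
Qed.

Lemma ps_mulA : associative ps_mul.
Proof.
move=> f g h; apply/funext => n.
transitivity ((ps_trunc n f * (ps_trunc n g * ps_trunc n h))`_n).
  rewrite coefM; apply: eq_bigr => i _.
  by rewrite coef_trunc_mul ?leq_subr // coef_poly ltn_ord.
rewrite mulrA coefM; apply: eq_bigr => i _.
by rewrite coef_trunc_mul ?leq_ord // coef_poly ltnS leq_subr.
Qed.

Lemma ps_mul1 : left_id ps_one ps_mul.
Proof.
move=> f; apply/funext => n; rewrite /ps_mul big_ord_recl /= mul1r subn0.
by rewrite big1 ?addr0 // => i _; rewrite mul0r.
Qed.

Lemma ps_mulDl : left_distributive ps_mul ps_add.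
Proof.
move=> f g h; apply/funext => n; rewrite /ps_mul /ps_add -big_split /=.
by apply: eq_bigr => i _; rewrite mulrDl.
Qed.

Lemma ps_one_neq0 : ps_one != ps_zero.
Proof. by apply/eqP => /(congr1 (@^~ 0%N)) /eqP; rewrite oner_eq0. Qed.

HB.instance Definition _ :=
  GRing.Zmodule_isComNzRing.Build (ps R) ps_mulA ps_mulC ps_mul1 ps_mulDl
    ps_one_neq0.

Lemma ps1E n : (1 : ps R) n = (n == 0%N)%:R.
Proof. by rewrite -[1]/ps_one /ps_one; case: eqP. Qed.
Lemma psDE f g n : (f + g) n = f n + g n. Proof. by []. Qed.
Lemma psNE f n : (- f) n = - f n. Proof. by []. Qed.
Lemma psME f g n : (f * g) n = \sum_(i < n.+1) f i * g (n - i)%N.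
Proof. by []. Qed.
Lemma psME0 f g : (f * g) 0%N = f 0%N * g 0%N.
Proof. by rewrite psME big_ord1. Qed.

Definition psC (c : R) : ps R := fun n => if n == 0%N then c else 0.

Lemma psCM c f n : (psC c * f) n = c * f n.
Proof.
rewrite psME big_ord_recl /= subn0 big1 ?addr0 // => i _.
by rewrite mul0r.
Qed.

Definition psX : ps R := fun n => (n == 1%N)%:R.

Lemma psXM0 f : (psX * f) 0%N = 0.
Proof. by rewrite psME0 mul0r. Qed.

Lemma psXMS f n : (psX * f) n.+1 = f n.
Proof.
rewrite psME 2!big_ord_recl /= mul0r add0r mul1r subSS subn0.
by rewrite big1 ?addr0 // => i _; rewrite mul0r.
Qed.

Lemma psC_is_zmod_morphism : zmod_morphism psC.
Proof.
move=> a b; apply/funext => n; rewrite psDE psNE /psC.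
by case: eqP => // _; rewrite subrr.
Qed.
HB.instance Definition _ :=
  GRing.isZmodMorphism.Build R (ps R) psC psC_is_zmod_morphism.

Lemma psC_is_monoid_morphism : monoid_morphism psC.
Proof.
split=> // a b; apply/funext => n; rewrite psCM /psC.
by case: eqP => // _; rewrite mulr0.
Qed.
HB.instance Definition _ :=
  GRing.isMonoidMorphism.Build R (ps R) psC psC_is_monoid_morphism.

(** The derivation b d/db.  Unlike d/db it preserves the degree in b, which
keeps index shifts out of the computations below. *)
Definition ps_theta f : ps R := fun n => n%:R * f n.

Lemma ps_theta_is_zmod_morphism : zmod_morphism ps_theta.
Proof. by move=> f g; apply/funext => n; rewrite /ps_theta psDE psNE mulrBr. Qed.
HB.instance Definition _ :=
  GRing.isZmodMorphism.Build (ps R) (ps R) ps_theta ps_theta_is_zmod_morphism.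

Lemma ps_thetaM f g : ps_theta (f * g) = ps_theta f * g + f * ps_theta g.
Proof.
apply/funext => n; rewrite psDE /ps_theta !psME mulr_sumr -big_split /=.
apply: eq_bigr => i _; rewrite -[in n%:R](subnKC (leq_ord i)) natrD; ring.
Qed.

Lemma ps_theta1 : ps_theta 1 = 0.
Proof.
by apply/funext => -[|n]; rewrite /ps_theta ps1E ?mul0r ?mulr0.
Qed.

Lemma ps_mulnE f m n : (f *+ m) n = f n *+ m.
Proof. by elim: m => // m IH; rewrite !mulrS psDE IH. Qed.

Lemma ps_mulzE f (m : int) n : (f *~ m) n = f n *~ m.
Proof.
by case: m => m; [|rewrite !NegzE !mulrNz psNE]; rewrite -!pmulrn ps_mulnE.
Qed.

End PowerSeriesRing.

Section PowerSeriesUnit.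
Context (K : fieldType).
Implicit Types f g h : ps K.

Lemma size_fps_inv_seq (f : fps K) n : size (fps_inv_seq f n) = n.
Proof. by elim: n => //= n IH; rewrite size_rcons IH. Qed.

Lemma nth_fps_inv_seq (f : fps K) n i : (i < n)%N ->
  (fps_inv_seq f n)`_i = fps_inv f i.
Proof.
elim: n => // n IH; rewrite ltnS leq_eqVlt => /predU1P[->//|lt_in].
by rewrite /= nth_rcons size_fps_inv_seq lt_in IH.
Qed.

Lemma fps_invE (f : fps K) n : fps_inv f n =
  ((n == 0%N)%:R - \sum_(i < n) f (n - i)%N * fps_inv f i) / f 0%N.
Proof.
rewrite {1}/fps_inv /= nth_rcons size_fps_inv_seq ltnn eqxx.
by under eq_bigr => i _ do rewrite nth_fps_inv_seq //.
Qed.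

Definition ps_unit : pred (ps K) := fun f => f 0%N != 0.
Definition ps_inv f : ps K := if ps_unit f then fps_inv f else f.

Lemma ps_mulV : {in ps_unit, left_inverse 1 ps_inv *%R}.
Proof.
move=> f uf; have f0 : f 0%N != 0 by [].
apply/funext => n.
rewrite psME /ps_inv /ps_unit f0 big_ord_recr /= subnn fps_invE divfK //.
rewrite ps1E addrC -[RHS](subrK (\sum_(i < n) f (n - i)%N * fps_inv f i)).
by congr (_ + _); apply: eq_bigr => i _; rewrite mulrC.
Qed.

Lemma ps_unitPl f g : g * f = 1 -> ps_unit f.
Proof.
move=> /(congr1 (@^~ 0%N)); rewrite psME0 /ps_unit => gf1.
by apply/eqP => f0; move/eqP: gf1; rewrite f0 mulr0 ps1E eq_sym oner_eq0.
Qed.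

Lemma ps_inv_out : {in [predC ps_unit], ps_inv =1 id}.
Proof.
by move=> f uf; rewrite /ps_inv; case: ifP => // uf'; move/negP: uf; case.
Qed.

HB.instance Definition _ :=
  GRing.ComNzRing_hasMulInverse.Build (ps K) ps_mulV ps_unitPl ps_inv_out.

Lemma unit_psE f : (f \is a GRing.unit) = (f 0%N != 0).
Proof. by []. Qed.

Lemma fps_inv_psE f : f 0%N != 0 -> fps_inv f = f^-1 :> ps K.
Proof. by move=> f0; rewrite -[f^-1]/(ps_inv f) /ps_inv /ps_unit f0. Qed.

Lemma psV0 f : f 0%N != 0 -> (f^-1) 0%N = (f 0%N)^-1.
Proof.
move=> f0; apply: (mulfI f0); rewrite -psME0 mulrV ?unit_psE //.
by rewrite divff.
Qed.

(** The logarithmic derivative b f' / f. *)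
Definition ps_dlog f : ps K := ps_theta f / f.

Lemma ps_dlogM f g : f \is a GRing.unit -> g \is a GRing.unit ->
  ps_dlog (f * g) = ps_dlog f + ps_dlog g.
Proof.
move=> uf ug; rewrite /ps_dlog ps_thetaM invrM // mulrDl mulrA mulrK //.
by rewrite [g^-1 * _]mulrC mulrACA divrr // mul1r.
Qed.

Lemma ps_dlog1 : ps_dlog (1 : ps K) = 0.
Proof. by rewrite /ps_dlog ps_theta1 mul0r. Qed.

Lemma ps_dlogV f : f \is a GRing.unit -> ps_dlog f^-1 = - ps_dlog f.
Proof.
move=> uf; apply/eqP; rewrite -subr_eq0 opprK addrC -ps_dlogM ?unitrV //.
by rewrite divrr // ps_dlog1.
Qed.

Lemma ps_dlog_exp f n : f \is a GRing.unit -> ps_dlog (f ^+ n) = ps_dlog f *+ n.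
Proof.
move=> uf; elim: n => [|n IH]; first by rewrite expr0 ps_dlog1.
by rewrite exprS ps_dlogM ?unitrX // IH mulrS.
Qed.

Lemma ps_dlog_expz f (z : int) : f \is a GRing.unit -> ps_dlog (f ^ z) = ps_dlog f *~ z.
Proof.
move=> uf; case: z => n; first exact: ps_dlog_exp.
rewrite -[f ^ _]/(f ^- n.+1) NegzE ps_dlogV ?unitrX //.
by rewrite ps_dlog_exp // mulrNz.
Qed.

End PowerSeriesUnit.

Section Substitution.
Context (R : comNzRingType).

Definition ps_scale (c : R) (f : ps R) : ps R := fun n => c ^+ n * f n.

Lemma ps_scale_is_zmod_morphism c : zmod_morphism (ps_scale c).
Proof. by move=> f g; apply/funext => n; rewrite /ps_scale mulrBr. Qed.
HB.instance Definition _ c :=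
  GRing.isZmodMorphism.Build (ps R) (ps R) (ps_scale c)
    (ps_scale_is_zmod_morphism c).

Lemma ps_scale_is_monoid_morphism c : monoid_morphism (ps_scale c).
Proof.
split=> [|f g]; apply/funext => n.
  by rewrite /ps_scale !ps1E; case: eqP => [->|_]; rewrite ?mulr1 ?mulr0.
rewrite /ps_scale !psME mulr_sumr; apply: eq_bigr => i _.
rewrite -[in c ^+ n](subnKC (leq_ord i)) exprD; ring.
Qed.
HB.instance Definition _ c :=
  GRing.isMonoidMorphism.Build (ps R) (ps R) (ps_scale c)
    (ps_scale_is_monoid_morphism c).
End Substitution.

Section MapCoefficients.
Context (R S : comNzRingType) (phi : {rmorphism R -> S}).

Definition ps_map (f : ps R) : ps S := fun n => phi (f n).

Lemma ps_map_is_zmod_morphism : zmod_morphism ps_map.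
Proof. by move=> f g; apply/funext => n; rewrite /ps_map rmorphB. Qed.
HB.instance Definition _ :=
  GRing.isZmodMorphism.Build (ps R) (ps S) ps_map ps_map_is_zmod_morphism.

Lemma ps_map_is_monoid_morphism : monoid_morphism ps_map.
Proof.
split=> [|f g]; apply/funext => n.
  by rewrite /ps_map !ps1E rmorph_nat.
rewrite /ps_map psME rmorph_sum; apply: eq_bigr => i _; exact: rmorphM.
Qed.
HB.instance Definition _ :=
  GRing.isMonoidMorphism.Build (ps R) (ps S) ps_map ps_map_is_monoid_morphism.
End MapCoefficients.

(** * Polynomials in x and their two top coefficients *)

Section TopCoefficients.
Context (K : fieldType).
Implicit Types p q : {poly K}.

Lemma coefM_top p q i j : (size p <= i.+1)%N -> (size q <= j.+1)%N ->
  (p * q)`_(i + j) = p`_i * q`_j.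
Proof.
move=> sp sq; have li : (i < (i + j).+1)%N by rewrite ltnS leq_addr.
rewrite coefM (bigD1 (Ordinal li)) //= addKn big1 ?addr0 // => k.
rewrite -val_eqE neq_ltn /= => /orP[ki|ik].
  rewrite [q`__]nth_default ?mulr0 // (leq_trans sq) // ltn_subRL.
  by rewrite ltn_add2r.
by rewrite [p`__]nth_default ?mul0r // (leq_trans sp).
Qed.

Lemma coefXM_top p q i j : (size p <= i.+1)%N -> (size q <= j.+1)%N ->
  ('X * (p * q))`_(i + j) = ('X * p)`_i * q`_j + p`_i * ('X * q)`_j.
Proof.
move=> sp sq; pose q' := q - q`_j *: 'X^j.
have sq' : (size ('X * q')%R <= j.+1)%N.
  apply/leq_sizeP => -[//|k] jk; rewrite coefXM /= coefB coefZ coefXn.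
  move: jk; rewrite ltnS leq_eqVlt => /predU1P[->|jk].
    by rewrite eqxx mulr1 subrr.
  rewrite gtn_eqF // mulr0 subr0 nth_default //; exact: leq_trans sq _.
have topq' : ('X * q')`_j = ('X * q)`_j.
  rewrite /q' mulrBr coefB -scalerAr -exprS coefZ coefXn ltn_eqF //.
  by rewrite mulr0 subr0.
have -> : 'X * (p * q) = p * ('X * q') + q`_j *: ('X * p * 'X^j).
  by rewrite /q' -!mul_polyC; ring.
rewrite coefD coefM_top // coefZ coefMXn ltnNge leq_addl /= addnK.
by rewrite topq' addrC mulrC.
Qed.

(** The n-th coefficient of [F] is a polynomial of degree at most n; [u] and [v]
record its coefficients of x^n and of x^(n-1).  Multiplying by 'X makes the
second one readable at index n, also for n = 0 where it has to vanish. *)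
Definition top_coefs (F : ps {poly K}) (u v : ps K) :=
  forall n, [/\ (size (F n) <= n.+1)%N, (F n)`_n = u n & ('X * F n)`_n = v n].

(** The two top coefficients multiply like dual numbers u + epsilon v. *)
Lemma top_coefs_mul F G u v u' v' : top_coefs F u v -> top_coefs G u' v' ->
  top_coefs (F * G) (u * u') (v * u' + u * v').
Proof.
move=> hF hG n; rewrite !psDE !psME; split.
- apply: (leq_trans (size_sum _ _ _)); apply/bigmax_leqP => i _.
  have [sF _ _] := hF i; have [sG _ _] := hG (n - i)%N.
  apply: (leq_trans (size_polyMleq _ _)).
  have := leq_add sF sG; rewrite addSn addnS subnKC ?leq_ord // => sFG.
  by rewrite -subn1 leq_subLR add1n.
- rewrite coef_sum; apply: eq_bigr => i _.
  have [sF <- _] := hF i; have [sG <- _] := hG (n - i)%N.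
  by rewrite -(coefM_top sF sG) subnKC ?leq_ord.
rewrite mulr_sumr coef_sum -big_split; apply: eq_bigr => i _ /=.
have [sF <- <-] := hF i; have [sG <- <-] := hG (n - i)%N.
by rewrite -(coefXM_top sF sG) subnKC ?leq_ord.
Qed.

(** In f (b (x + c)) the coefficient of b^n is f_n (x + c)^n, which starts with
f_n x^n + n c f_n x^(n-1). *)
Lemma top_coefs_linear (f : ps K) c :
  top_coefs (ps_scale ('X + c%:P) (ps_map polyC f)) f (psC c * ps_theta f).
Proof.
move=> n; rewrite psCM /ps_scale /ps_map /ps_theta mulrC mul_polyC.
have sX m : size (('X + c%:P) ^+ m) = m.+1.
  by rewrite -[c]opprK polyCN size_exp_XsubC.
have cX m : (('X + c%:P) ^+ m)`_m = 1.
  have /monicP := monic_exp m (monicXsubC (- c)).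
  by rewrite /lead_coef polyCN opprK sX.
have cX' m : (('X + c%:P) ^+ m.+1)`_m = m.+1%:R * c.
  elim: m => [|m IH]; first by rewrite expr1 coefD coefX coefC add0r mul1r.
  rewrite exprS mulrDl coefD coefXM /= IH coefCM cX mulr1 -[m.+2%:R]natr1.
  by rewrite mulrDl mul1r.
split; first by rewrite (leq_trans (size_scale_leq _ _)) // sX.
  by rewrite coefZ cX mulr1.
rewrite -scalerAr coefZ coefXM; case: n => [|n] /=; first by rewrite !(mulr0, mul0r).
by rewrite cX'; ring.
Qed.

(** A series with constant coefficients 1 + e_2 b^2 + ... does not affect the two
top coefficients: its linear term is the only one that could. *)
Lemma top_coefs_const (e : ps K) : e 0%N = 1 -> e 1%N = 0 ->
  top_coefs (ps_map polyC e) 1 0.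
Proof.
move=> e0 e1 n; rewrite /ps_map ps1E; split.
- by rewrite (leq_trans (size_polyC_leq1 _)).
- by rewrite coefC; case: eqP => // ->.
- by rewrite coefXM coefC; case: n => [|[|n]].
Qed.

(** With v = u w, the additive datum w plays the role of a logarithmic
derivative. *)
Lemma top_coefs_prod I (r : seq I) (P : pred I) (F : I -> ps {poly K})
    (u w : I -> ps K) :
  (forall i, P i -> top_coefs (F i) (u i) (u i * w i)) ->
  top_coefs (\prod_(i <- r | P i) F i) (\prod_(i <- r | P i) u i)
    ((\prod_(i <- r | P i) u i) * \sum_(i <- r | P i) w i).
Proof.
move=> hF; elim: r => [|i r IH].
  by rewrite !big_nil mulr0 -(rmorph1 (ps_map polyC)); exact: top_coefs_const.
rewrite !big_cons; case: ifP => // Pi.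
rewrite [X in top_coefs _ _ X](_ : _ = u i * w i * \prod_(j <- r | P j) u j
  + u i * ((\prod_(j <- r | P j) u j) * \sum_(j <- r | P j) w j)); last by ring.
by apply: top_coefs_mul => //; apply: hF.
Qed.

End TopCoefficients.

(** * Sums of residues *)

Section Residues.
Context (K : fieldType) (I : finType) (z : I -> K) (M : nat).
Hypothesis z_inj : injective z.
Hypothesis card_index : #|I| = M.+1.

Let den s := \prod_(t | t != s) (z s - z t).
Let basis s : {poly K} := \prod_(t | t != s) ('X - (z t)%:P).

Let den_neq0 s : den s != 0.
Proof.
by apply/prodf_neq0 => t ts; rewrite subr_eq0 (inj_eq z_inj) eq_sym.
Qed.

Let basisE s t : (basis s).[z t] = if t == s then den s else 0.
Proof.
rewrite horner_prod; case: eqP => [->|/eqP ts].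
  by apply: eq_bigr => j _; rewrite hornerXsubC.
by rewrite (bigD1 t) //= hornerXsubC subrr mul0r.
Qed.

Let size_basis s : size (basis s) = M.+1.
Proof.
rewrite /basis -big_filter size_prod_XsubC; congr _.+1.
have := cardC1 s; rewrite card_index /= => <-.
by rewrite -sum1_size big_filter sum1_card.
Qed.

(** Compare the coefficients of x^M in the Lagrange interpolation formula. *)
Lemma lagrange_sum (q : {poly K}) : (size q <= M.+1)%N ->
  \sum_s q.[z s] / den s = q`_M.
Proof.
move=> sq.
have {2}-> : q = \sum_s (q.[z s] / den s) *: basis s.
  apply/eqP; rewrite -subr_eq0; apply/eqP.
  pose rs := [seq z s | s <- enum I].
  apply: (@roots_geq_poly_eq0 _ _ rs).
  - apply/allP => _ /mapP[t _ ->]; rewrite rootE hornerD hornerN horner_sum.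
    rewrite (bigD1 t) //= big1 ?addr0 => [|s st].
      by rewrite hornerZ basisE eqxx divfK // subrr.
    by rewrite hornerZ basisE eq_sym (negbTE st) mulr0.
  - by rewrite map_inj_uniq ?enum_uniq.
  rewrite size_map -cardE card_index (leq_trans (size_polyD _ _)) // geq_max sq.
  rewrite size_polyN (leq_trans (size_sum _ _ _)) //; apply/bigmax_leqP => s _.
  by rewrite (leq_trans (size_scale_leq _ _)) // size_basis.
rewrite coef_sum; apply: eq_bigr => s _; rewrite coefZ.
have /monicP : basis s \is monic by rewrite monic_prod_XsubC.
by rewrite /lead_coef size_basis /= => ->; rewrite mulr1.
Qed.

(** The left-hand side is the sum of the residues of p / prod_s (x - z_s) at its
poles, hence minus the residue at infinity.  Subtracting a multiple of the
denominator from [p] changes no value p (z_s) and reduces to the degree of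
Lagrange interpolation. *)
Lemma residue_sum (p : {poly K}) : (size p <= M.+2)%N ->
  \sum_s p.[z s] / den s = p`_M + p`_M.+1 * \sum_s z s.
Proof.
move=> sp; pose W : {poly K} := \prod_s ('X - (z s)%:P).
have WE : W = \prod_(c <- [seq z s | s <- enum I]) ('X - c%:P).
  by rewrite big_map big_enum.
have sW : size W = M.+2 by rewrite WE size_prod_XsubC size_map -cardE card_index.
have W1 : W`_M.+1 = 1.
  have /monicP : W \is monic by rewrite monic_prod_XsubC.
  by rewrite /lead_coef sW.
have W2 : W`_M = - \sum_s z s.
  have := @coefPn_prod_XsubC _ [seq z s | s <- enum I].
  by rewrite -WE size_map -cardE card_index big_map big_enum => ->.
pose q := p - p`_M.+1 *: W.
have sq : (size q <= M.+1)%N.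
  apply/leq_sizeP => k; rewrite leq_eqVlt => /predU1P[<-|Mk].
    by rewrite coefB coefZ W1 mulr1 subrr.
  by rewrite nth_default // (leq_trans (size_polyD _ _)) // geq_max size_polyN
    (leq_trans sp) // (leq_trans (size_scale_leq _ _)) // sW.
transitivity (\sum_s q.[z s] / den s).
  apply: eq_bigr => s _; congr (_ / _).
  rewrite hornerD hornerN hornerZ horner_prod (bigD1 s) //= hornerXsubC.
  by rewrite subrr mul0r mulr0 subr0.
by rewrite lagrange_sum // coefB coefZ W2 mulrN opprK.
Qed.

End Residues.

Section ResidueSeries.
Context (K : fieldType) (I : finType) (z : I -> K) (M : nat).
Hypothesis z_inj : injective z.
Hypothesis card_index : #|I| = M.+1.
Hypothesis M_neq0 : M.+1%:R != 0 :> K.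
Context (J : Type) (r : seq J) (a : J -> int) (c : J -> K).
Context (e f g : ps K).
Hypotheses (e0 : e 0%N = 1) (e1 : e 1%N = 0).
Hypotheses (uf : f \is a GRing.unit) (ug : g \is a GRing.unit).

(** The product, over the weights of alpha and of T^red, of the corresponding
characteristic series at b; [e] stands for the factors independent of x. *)
Definition integrand (x : K) : ps K :=
  e * (\prod_(j <- r) ps_scale (x + c j) (f ^ a j)
       * \prod_t ps_scale (x - z t) g).

(** The same product with x the indeterminate of {poly K}. *)
Let F : ps {poly K} := ps_map polyC e *
  (\prod_(j <- r) ps_scale ('X + (c j)%:P) (ps_map polyC (f ^ a j))
   * \prod_t ps_scale ('X + (- z t)%:P) (ps_map polyC g)).

Let rho := \sum_(j <- r) a j.
Let A := \sum_(j <- r) c j *~ a j.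
Let Z := \sum_s z s.
Let u := f ^ rho * g ^+ M.+1.

Lemma integrandE x n : (F n).[x] = integrand x n.
Proof.
rewrite -[LHS]/(ps_map (horner_eval x) F n) /F /integrand; congr (_ n).
have psx : ps_map (horner_eval x) \o ps_map polyC =1 id.
  by move=> h; apply/funext => i; rewrite /ps_map /= /horner_eval hornerC.
have psxs y h : ps_map (horner_eval x) (ps_scale ('X + y%:P) (ps_map polyC h))
    = ps_scale (x + y) h.
  apply/funext => i; rewrite /ps_map /ps_scale rmorphM rmorphXn /=.
  by rewrite /horner_eval hornerD hornerX !hornerC.
rewrite rmorphM rmorphM rmorph_prod rmorph_prod /=.
rewrite [ps_map _ (ps_map _ e)](psx e).
under eq_bigr => j _ do rewrite psxs.
by under [X in _ * (_ * X)]eq_bigr => t _ do rewrite psxs.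
Qed.

Lemma prodr_expz (s : seq J) : \prod_(j <- s) f ^ a j = f ^ \sum_(j <- s) a j.
Proof.
by elim: s => [|j s IH]; rewrite ?big_nil // !big_cons IH exprzDr.
Qed.

Lemma top_coefs_integrand : top_coefs F u (u * (psC A * ps_dlog f - psC Z * ps_dlog g)).
Proof.
have linear (h : ps K) (y : K) : h \is a GRing.unit ->
    top_coefs (ps_scale ('X + y%:P) (ps_map polyC h)) h (h * (psC y * ps_dlog h)).
  move=> uh; have -> : h * (psC y * ps_dlog h) = psC y * ps_theta h.
    by rewrite /ps_dlog mulrC mulrA divrK.
  exact: top_coefs_linear.
have hf := top_coefs_prod r (P := xpredT) (fun j _ =>
  linear (f ^ a j) (c j) (unitrXz (a j) uf)).
have hg := top_coefs_prod (index_enum I) (P := xpredT) (fun t _ =>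
  linear g (- z t) ug).
rewrite prodr_expz in hf; rewrite prodr_const card_index in hg.
have := top_coefs_mul (top_coefs_const e0 e1) (top_coefs_mul hf hg).
have -> : \sum_(j <- r) psC (c j) * ps_dlog (f ^ a j) = psC A * ps_dlog f.
  rewrite /A raddf_sum mulr_suml; apply: eq_bigr => j _.
  by rewrite ps_dlog_expz // raddfMz mulrzAl mulrzAr.
have -> : \sum_t psC (- z t) * ps_dlog g = - psC Z * ps_dlog g.
  rewrite -mulr_suml; under eq_bigr => t _ do rewrite raddfN.
  by rewrite sumrN -raddf_sum.
rewrite !mul1r mul0r add0r -/rho -/u.
set v := (X in top_coefs _ _ X); set v' := (X in _ -> top_coefs _ _ X).
by have -> : v = v' by rewrite /v /v' /u; ring.
Qed.

(** The top coefficients give A (u f~)_M1 - Z (u g~)_M1 + Z u_M1, where f~ and g~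
are logarithmic derivatives and M1 is the number of points.  The logarithmic
derivative of u = f^rho g^M1 is rho f~ + M1 g~; reading off the coefficient of
b^M1 eliminates g~. *)
Lemma residue_series :
  \sum_s integrand (z s) M.+1 / (\prod_(t | t != s) (z s - z t)) =
  (A + rho%:~R / M.+1%:R * Z) * (u * ps_dlog f) M.+1.
Proof.
pose p := F M.+1; have [sp up vp] := top_coefs_integrand M.+1.
under eq_bigr => s _ do rewrite -integrandE.
rewrite (residue_sum z_inj card_index) // -/Z.
move: vp; rewrite coefXM /= => ->; rewrite up.
have Lu : ps_theta u = u * (ps_dlog f *~ rho + ps_dlog g *+ M.+1).
  rewrite -ps_dlog_expz // -ps_dlog_exp // -ps_dlogM ?unitrX ?unitrXz //.
  by rewrite [ps_dlog (_ * _)]/ps_dlog mulrC divrK // unitrM unitrX // unitrXz.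
have {Lu} : M.+1%:R * u M.+1 =
    rho%:~R * (u * ps_dlog f) M.+1 + M.+1%:R * (u * ps_dlog g) M.+1.
  rewrite -[LHS]/(ps_theta u M.+1) Lu mulrDr mulrzAr mulrnAr psDE.
  by rewrite ps_mulzE ps_mulnE mulrzl mulr_natl.
have -> : u * (psC A * ps_dlog f - psC Z * ps_dlog g) =
    psC A * (u * ps_dlog f) - psC Z * (u * ps_dlog g) by ring.
rewrite psDE psNE !psCM.
move: (u M.+1) ((u * ps_dlog f) M.+1) ((u * ps_dlog g) M.+1) => U P Q eqU.
have -> : U = rho%:~R * P / M.+1%:R + Q.
  by apply: (mulfI M_neq0); rewrite eqU mulrDr mulrCA divff // mulr1.
ring.
Qed.

End ResidueSeries.

(** * The series of the Segre and Verlinde classes *)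

Section SpecialSeries.
Context (K : fieldType).
Hypothesis char0 : forall n, n.+1%:R != 0 :> K.

Let factV n : n.+1%:R / n.+1`!%:R = n`!%:R^-1 :> K.
Proof. by rewrite factS natrM invfM mulrA divff ?mul1r. Qed.

Definition exp_ps : ps K := fps_exp 1.
Definition segre_ps : ps K := (fps_lin 1 1 : ps K)^-1.
(** (1 - exp (- b)) / b. *)
Definition todd_inv : ps K := fun n => - fps_exp (-1 : K) n.+1.
Definition todd_ps : ps K := todd_inv^-1.

Lemma ps_theta_exp (c : K) : ps_theta (fps_exp c : ps K) = psC c * (psX K * fps_exp c).
Proof.
apply/funext => n; rewrite psCM /ps_theta /fps_exp.
case: n => [|n]; first by rewrite psXM0 mulr0 mul0r.
by rewrite psXMS mulrCA factV exprS mulrA.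
Qed.

Lemma fps_exp0 (c : K) : fps_exp c 0%N = 1.
Proof. by rewrite /fps_exp expr0 fact0 divr1. Qed.

Lemma exp_unit c : (fps_exp c : ps K) \is a GRing.unit.
Proof. by rewrite unit_psE fps_exp0 oner_neq0. Qed.

Lemma ps_scale_exp c : ps_scale c exp_ps = fps_exp c.
Proof. by apply/funext => n; rewrite /ps_scale /exp_ps /fps_exp expr1n mul1r. Qed.

Lemma ps_theta_eq0 (f : ps K) : ps_theta f = 0 -> f = psC (f 0%N).
Proof.
move=> Df; apply/funext => -[//|n].
apply: (mulfI (char0 n)); rewrite mulr0.
by rewrite -[LHS]/(ps_theta f n.+1) Df.
Qed.

Lemma exp_expN : (fps_exp (-1) : ps K) = exp_ps^-1.
Proof.
have uE := exp_unit 1; apply: (mulIr uE); rewrite mulVr //.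
rewrite [LHS]ps_theta_eq0 ?psME0 ?fps_exp0 ?mulr1 ?rmorph1 //.
by rewrite ps_thetaM !ps_theta_exp rmorphN rmorph1; ring.
Qed.

Lemma todd_inv0 : todd_inv 0%N = 1.
Proof. by rewrite /todd_inv /fps_exp expr1 (_ : 1`! = 1)%N // divr1 opprK. Qed.

Lemma todd_unit : todd_ps \is a GRing.unit.
Proof. by rewrite unitrV unit_psE todd_inv0 oner_neq0. Qed.

Lemma segre_inv0 : (fps_lin 1 1 : ps K) \is a GRing.unit.
Proof. by rewrite unit_psE oner_neq0. Qed.

Lemma segre_unit : segre_ps \is a GRing.unit.
Proof. by rewrite unitrV segre_inv0. Qed.

Lemma ps_dlog_exp_ps : ps_dlog exp_ps = psX K.
Proof. by rewrite /ps_dlog ps_theta_exp rmorph1 mul1r mulrK ?exp_unit. Qed.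

(** This is b td' = td - td^2 exp (- b), the Riccati equation of the Todd
series. *)
Lemma ps_dlog_todd : ps_dlog todd_ps = 1 - todd_ps / exp_ps.
Proof.
have uT : todd_inv \is a GRing.unit by rewrite unit_psE todd_inv0 oner_neq0.
have DT : ps_theta todd_inv = exp_ps^-1 - todd_inv.
  rewrite -exp_expN; apply/funext => n; rewrite psDE psNE /ps_theta /todd_inv /fps_exp.
  rewrite opprK exprS mulN1r mulNr opprK.
  set y := _ / n.+1`!%:R; rewrite -[LHS](addrK y); congr (_ - _).
  by rewrite -[X in _ + X]mul1r -mulrDl natr1 /y mulrCA factV.
by rewrite ps_dlogV // /ps_dlog DT mulrBl divrr // opprB mulrC.
Qed.

Lemma ps_dlog_segre : ps_dlog segre_ps = - (psX K * segre_ps).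
Proof.
rewrite ps_dlogV ?segre_inv0 // /ps_dlog; congr (- (_ / _)).
by apply/funext => -[|[|n]]; rewrite /ps_theta /psX /= ?mul0r ?mulr1 ?mulr0.
Qed.

Lemma ps_exprz0 (f : ps K) (k : int) : f 0%N = 1 -> (f ^ k) 0%N = 1.
Proof.
move=> f0; have fn n : (f ^+ n) 0%N = 1.
  by elim: n => // n IH; rewrite exprS psME0 IH f0 mulr1.
case: k => n; first exact: fn.
by rewrite -[f ^ _]/((f ^+ n.+1)^-1) psV0 fn ?invr1 ?oner_neq0.
Qed.

Lemma todd_ps0 : todd_ps 0%N = 1.
Proof. by rewrite /todd_ps psV0 todd_inv0 ?invr1 ?oner_neq0. Qed.

Lemma segre_ps0 : segre_ps 0%N = 1.
Proof. by rewrite /segre_ps psV0 /= ?invr1 ?oner_neq0. Qed.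

(** The residues at 0 of exp (k b) / (1 - exp (- b))^(M+1) and of
(1 + b)^(-k-1) / b^(M+1). *)
Definition verlinde_coef (k : int) M := (exp_ps ^ k * todd_ps ^+ M.+1) M.
Definition segre_coef (k : int) M := (segre_ps ^ (k + 1)) M.

Lemma ps_theta_expz_mul f g (k : int) m : f \is a GRing.unit -> g \is a GRing.unit ->
  ps_theta (f ^ k * g ^+ m : ps K) = (f ^ k * g ^+ m) * (ps_dlog f *~ k + ps_dlog g *+ m).
Proof.
move=> uf ug; rewrite -ps_dlog_expz // -ps_dlog_exp // -ps_dlogM ?unitrX ?unitrXz //.
by rewrite [ps_dlog (_ * _)]/ps_dlog [RHS]mulrC divrK // unitrM unitrX ?unitrXz.
Qed.

(** The residue of the derivative of exp ((k+1) b) / (1 - exp (- b))^(M+1)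
vanishes. *)
Lemma verlinde_coefS k M :
  M.+1%:R * verlinde_coef k M.+1 = (k + 1)%:~R * verlinde_coef (k + 1) M.
Proof.
have /(congr1 (fun h : ps K => h M.+1)) :=
  ps_theta_expz_mul (k + 1) M.+1 (exp_unit 1) todd_unit.
rewrite ps_dlog_exp_ps ps_dlog_todd mulrDr mulrzAr mulrnAr mulrBr mulr1.
rewrite psDE ps_mulzE ps_mulnE [_ * psX K]mulrC psXMS psDE psNE.
rewrite {1}/ps_theta mulrnBl mulr_natl addrCA -[LHS]addr0 => /addrI /esym /eqP.
rewrite subr_eq0 mulrzl => /eqP ->; rewrite mulr_natl /verlinde_coef; congr (_ M.+1 *+ _).
rewrite -/exp_ps exprzDr ?exp_unit // expr1z [todd_ps ^+ M.+2]exprSr.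
have -> : exp_ps ^ k * exp_ps * todd_ps ^+ M.+1 * (todd_ps / exp_ps) =
    exp_ps ^ k * (todd_ps ^+ M.+1 * todd_ps) * (exp_ps / exp_ps) by ring.
by rewrite divrr ?exp_unit // mulr1.
Qed.

(** The derivative of (1 + b)^(-k-1) is -(k+1) (1 + b)^(-k-2). *)
Lemma segre_coefS k M :
  M.+1%:R * segre_coef k M.+1 = - (k + 1)%:~R * segre_coef (k + 1) M.
Proof.
have /(congr1 (fun h : ps K => h M.+1)) :=
  ps_theta_expz_mul (k + 1) 0 segre_unit segre_unit.
rewrite !(mulr1, mulr0n, addr0) ps_dlog_segre /ps_theta => ->.
rewrite mulrzAr ps_mulzE mulrN psNE mulNrz mulNr mulrzl; congr (- (_ *~ _)).
by rewrite mulrCA psXMS /segre_coef [in RHS]exprzDr ?segre_unit.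
Qed.

(** Both families are determined by their recursions and equal 1 at M = 0; the
recursions differ by a sign. *)
Lemma segre_coef_verlinde k M :
  segre_coef k M = (-1) ^+ M * verlinde_coef k M.
Proof.
elim: M k => [|M IH] k.
  rewrite /segre_coef /verlinde_coef mul1r psME0 expr1 !ps_exprz0 ?fps_exp0 //.
    by rewrite todd_ps0 mulr1 //.
    exact: fps_exp0.
  exact: segre_ps0.
apply: (mulfI (char0 M)); rewrite segre_coefS IH.
by rewrite [RHS]mulrCA verlinde_coefS exprS; ring.
Qed.

Lemma segre_coef_fact (k M : nat) :
  M`!%:R * k`!%:R * segre_coef k M = (-1) ^+ M * (k + M)`!%:R.
Proof.
elim: M k => [|M IH] k.
  rewrite addn0 fact0 !mul1r /segre_coef ps_exprz0 ?mulr1 //.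
  exact: segre_ps0.
have := segre_coefS k M; rewrite [k%:Z + 1]addrC -intS => eqS.
rewrite addnS -addSn exprS -[RHS]mulrA -IH !factS !natrM.
rewrite [LHS](_ : _ = M`!%:R * k`!%:R * (M.+1%:R * segre_coef k M.+1)).
  by rewrite eqS -pmulrn; ring.
by ring.
Qed.

End SpecialSeries.

(** * Virtual characters *)

Section LinearEvaluation.
Context (X : zmodType) (V : zmodType).
Implicit Types (g h : vchar X) (psi : X -> V).

(** The additive extension of [psi] from characters to virtual characters. *)
Definition lin_eval psi g : V := \sum_(x <- dom g) psi x *~ coeff x g.

Lemma lin_eval_sub psi g (r : seq X) : uniq r -> {subset dom g <= r} ->
  lin_eval psi g = \sum_(x <- r) psi x *~ coeff x g.
Proof.
move=> ur sr; rewrite (bigID (mem (dom g))) /= [X in _ + X]big1 ?addr0.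
  rewrite -big_filter; apply: perm_big; apply: uniq_perm.
  - exact: uniq_dom.
  - exact: filter_uniq.
  - move=> x; rewrite mem_filter /=; case: (boolP (x \in dom g)) => // xg.
    by rewrite sr.
by move=> x xg; rewrite coeff_outdom // mulr0z.
Qed.

Lemma lin_eval_is_zmod_morphism psi : zmod_morphism (lin_eval psi).
Proof.
move=> g h; set r := undup (dom g ++ dom h).
have ur : uniq r by apply: undup_uniq.
have sg : {subset dom g <= r} by move=> x xg; rewrite mem_undup mem_cat xg.
have sh : {subset dom h <= r}.
  by move=> x xg; rewrite mem_undup mem_cat xg orbT.
have sgh : {subset dom (g - h) <= r}.
  by move=> x /domB; rewrite mem_undup.
rewrite !(@lin_eval_sub psi _ r) // -sumrB; apply: eq_bigr => x _.
by rewrite coeffB mulrzBr.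
Qed.
HB.instance Definition _ psi :=
  GRing.isZmodMorphism.Build (vchar X) V (lin_eval psi) (lin_eval_is_zmod_morphism psi).

Lemma lin_evalZU psi c x : lin_eval psi << c *g x >> = psi x *~ c.
Proof.
have [->|c0] := eqVneq c 0; first by rewrite freegU0 raddf0.
by rewrite /lin_eval domU // big_seq1 coeffU eqxx mulr1.
Qed.

Lemma lin_evalU psi x : lin_eval psi << x >> = psi x.
Proof. exact: lin_evalZU. Qed.

Lemma freegUz c (x : X) : << c *g x >> = << x >> *~ c :> vchar X.
Proof. by rewrite freeg_mulz intz. Qed.

Lemma additive_lin_eval (f : {additive vchar X -> V}) g :
  f g = lin_eval (fun x => f << x >>) g.
Proof.
rewrite -{1}(freeg_sumE g) raddf_sum; apply: eq_bigr => x _.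
by rewrite freegUz raddfMz.
Qed.

Lemma eq_lin_eval psi psi' g : psi =1 psi' -> lin_eval psi g = lin_eval psi' g.
Proof. by move=> e; apply: eq_bigr => x _; rewrite e. Qed.

End LinearEvaluation.

Lemma raddf_lin_eval (X V W : zmodType) (f : {additive V -> W}) (psi : X -> V)
    (g : vchar X) : f (lin_eval psi g) = lin_eval (f \o psi) g.
Proof. by rewrite /lin_eval raddf_sum; apply: eq_bigr => x _; rewrite raddfMz. Qed.

Section CharacterRing.
Context (X : zmodType).
Implicit Types (g h : vchar X).

Lemma vmulE g h : vmul g h = lin_eval (fun x => lin_eval (fun y => << x + y >>) h) g.
Proof.
apply: eq_bigr => x _; rewrite /lin_eval mulrz_suml; apply: eq_bigr => y _.
by rewrite freegUz mulrzAC -mulrzA.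
Qed.

Lemma vmulC g h : vmul g h = vmul h g.
Proof.
rewrite /vmul exchange_big; apply: eq_bigr => x _; apply: eq_bigr => y _.
by rewrite mulrC addrC.
Qed.

Lemma vmulBl g g' h : vmul (g - g') h = vmul g h - vmul g' h.
Proof. by rewrite !vmulE raddfB. Qed.

Lemma vmulBr g h h' : vmul g (h - h') = vmul g h - vmul g h'.
Proof. by rewrite ![vmul g _]vmulC vmulBl. Qed.

HB.instance Definition _ g :=
  GRing.isZmodMorphism.Build (vchar X) (vchar X) (vmul g) (vmulBr g).

Lemma vmul0l h : vmul 0 h = 0.
Proof. by rewrite vmulC raddf0. Qed.

Lemma vmulUl x h : vmul << x >> h = lin_eval (fun y => << x + y >>) h.
Proof. by rewrite vmulE lin_evalU. Qed.

Lemma vmulUU (x y : X) : vmul << x >> << y >> = << x + y >>.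
Proof. by rewrite vmulUl lin_evalU. Qed.

Lemma vmul_levl (Y : zmodType) (psi : Y -> vchar X) (g : vchar Y) h :
  vmul (lin_eval psi g) h = lin_eval (fun x => vmul (psi x) h) g.
Proof. by rewrite vmulC raddf_lin_eval; apply: eq_lin_eval => x; apply: vmulC. Qed.

Lemma vmulA g h k : vmul g (vmul h k) = vmul (vmul g h) k.
Proof.
rewrite [vmul g h]vmulE vmul_levl vmulE; apply: eq_lin_eval => x.
rewrite -vmulUl [vmul h k]vmulE raddf_lin_eval vmul_levl; apply: eq_lin_eval => y /=.
rewrite raddf_lin_eval vmulUl; apply: eq_lin_eval => z /=.
by rewrite vmulUU addrA.
Qed.

Lemma vmulACA (a b c d : vchar X) :
  vmul (vmul a b) (vmul c d) = vmul (vmul a c) (vmul b d).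
Proof. by rewrite !vmulA -[vmul (vmul a b) c]vmulA [vmul b c]vmulC !vmulA. Qed.

Lemma vmul0x h : vmul << 0 >> h = h.
Proof.
rewrite vmulUl -[RHS](freeg_sumE h); apply: eq_bigr => x _.
by rewrite add0r -freegUz.
Qed.

Lemma vbarE g : vbar g = lin_eval (fun x => << - x >>) g.
Proof. by apply: eq_bigr => x _; rewrite freegUz. Qed.

Lemma vbar_is_zmod_morphism : zmod_morphism (@vbar X).
Proof. by move=> g h; rewrite !vbarE raddfB. Qed.
HB.instance Definition _ :=
  GRing.isZmodMorphism.Build (vchar X) (vchar X) (@vbar X)
    vbar_is_zmod_morphism.

Lemma vbarU (x : X) : vbar << x >> = << - x >>.
Proof. by rewrite vbarE lin_evalU. Qed.

Lemma vbarM g h : vbar (vmul g h) = vmul (vbar g) (vbar h).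
Proof.
rewrite (vmulE g h) !raddf_lin_eval (vbarE g) vmul_levl; apply: eq_lin_eval => x /=.
rewrite raddf_lin_eval vbarE raddf_lin_eval; apply: eq_lin_eval => y /=.
by rewrite vbarU vmulUU opprD.
Qed.

Lemma coeffU1 (x y : X) : coeff x (<< y >> : vchar X) = (y == x)%:R.
Proof. by rewrite coeffU mul1r. Qed.

Lemma coeff_lin_eval x g : coeff x g = lin_eval (fun y => (y == x)%:R) g.
Proof.
rewrite (additive_lin_eval (coeff x)); apply: eq_lin_eval => y; exact: coeffU1.
Qed.

Lemma coeff_vmulUr x w g : coeff x (vmul g << w >>) = coeff (x - w) g.
Proof.
rewrite vmulC vmulUl (raddf_lin_eval (coeff x)) coeff_lin_eval.
apply: eq_lin_eval => y /=.
by rewrite coeffU1 addrC -[w in LHS]opprK subr_eq.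
Qed.

Lemma coeff0_norm g : coeff 0 (vmul (vbar g) g) = \sum_(x <- dom g) coeff x g ^+ 2.
Proof.
rewrite vbarE vmul_levl (raddf_lin_eval (coeff 0)); apply: eq_bigr => x _ /=.
by rewrite vmulC coeff_vmulUr sub0r opprK -mulrzr intz.
Qed.

(** The left-hand side is linear in [g], so that a lower bound for the sum of the
squares of the coefficients can be computed on a decomposition of [g] into
characters. *)
Lemma coeff0_norm_ge (sgn : X -> int) g :
  (forall x, `|sgn x| <= 1) -> lin_eval sgn g <= coeff 0 (vmul (vbar g) g).
Proof.
move=> s1; rewrite coeff0_norm; apply: ler_sum => x _.
rewrite -mulrzr intz; apply: (le_trans (ler_norm _)).
rewrite normrM -[in _ ^+ 2]real_normK ?num_real //.
have [->|c0] := eqVneq (coeff x g) 0; first by rewrite normr0 mulr0.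
rewrite expr2 ler_pM2r ?normr_gt0 // (le_trans (s1 x)) //.
by rewrite -gtz0_ge1 normr_gt0.
Qed.

End CharacterRing.

Section MultiplicativeEvaluation.
Context (X : zmodType) (R : comUnitRingType).
Implicit Types (g h : vchar X) (phi : X -> R).

(** The multiplicative extension of [phi]; it sends sums to products as soon as
all the values are invertible. *)
Definition mul_eval phi g : R := \prod_(x <- dom g) phi x ^ coeff x g.

Lemma mul_eval_sub phi g (r : seq X) : uniq r -> {subset dom g <= r} ->
  mul_eval phi g = \prod_(x <- r) phi x ^ coeff x g.
Proof.
move=> ur sr; rewrite [RHS](bigID (mem (dom g))) /= [X in _ * X]big1 ?mulr1.
  rewrite -big_filter; apply: perm_big; apply: uniq_perm.
  - exact: uniq_dom.
  - exact: filter_uniq.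
  - move=> x; rewrite mem_filter /=; case: (boolP (x \in dom g)) => // xg.
    by rewrite sr.
by move=> x xg; rewrite coeff_outdom // expr0z.
Qed.

Lemma eq_mul_eval phi phi' g : (forall x, x \in dom g -> phi x = phi' x) ->
  mul_eval phi g = mul_eval phi' g.
Proof. by move=> e; apply: eq_big_seq => x xg; rewrite e. Qed.

Lemma mul_eval0 phi : mul_eval phi 0 = 1.
Proof. by rewrite /mul_eval dom0 big_nil. Qed.

Context (phi : X -> R).
Hypothesis phi_unit : forall x, phi x \is a GRing.unit.

Lemma mul_evalD g h : mul_eval phi (g + h) = mul_eval phi g * mul_eval phi h.
Proof.
set r := undup (dom g ++ dom h).
have ur : uniq r by apply: undup_uniq.
have sg : {subset dom g <= r} by move=> x xg; rewrite mem_undup mem_cat xg.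
have sh : {subset dom h <= r}.
  by move=> x xg; rewrite mem_undup mem_cat xg orbT.
have sgh : {subset dom (g + h) <= r}.
  by move=> x /domD_subset; rewrite mem_undup.
rewrite !(@mul_eval_sub phi _ r) // -big_split; apply: eq_bigr => x _ /=.
by rewrite coeffD exprzDr.
Qed.

Lemma mul_eval_sum I (r : seq I) (P : pred I) (F : I -> vchar X) :
  mul_eval phi (\sum_(i <- r | P i) F i) = \prod_(i <- r | P i) mul_eval phi (F i).
Proof. exact: (big_morph _ mul_evalD (mul_eval0 phi)). Qed.

Lemma mul_evalZU c x : mul_eval phi << c *g x >> = phi x ^ c.
Proof.
have [->|c0] := eqVneq c 0; first by rewrite freegU0 mul_eval0 expr0z.
by rewrite /mul_eval domU // big_seq1 coeffU eqxx mulr1.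
Qed.

Lemma mul_evalU x : mul_eval phi << x >> = phi x.
Proof. by rewrite mul_evalZU expr1z. Qed.

Lemma mul_eval_lin_eval (Y : zmodType) (psi : Y -> vchar X) (g : vchar Y) :
  mul_eval phi (lin_eval psi g) = \prod_(x <- dom g) mul_eval phi (psi x) ^ coeff x g.
Proof.
have mul_evalN h : mul_eval phi h * mul_eval phi (- h) = 1.
  by rewrite -mul_evalD subrr mul_eval0.
have uM h : mul_eval phi h \is a GRing.unit.
  by apply/unitrP; exists (mul_eval phi (- h)); rewrite mulrC mul_evalN.
have mul_evalMn h m : mul_eval phi (h *+ m) = mul_eval phi h ^+ m.
  by elim: m => [|m IH]; rewrite ?mul_eval0 // mulrS exprS mul_evalD IH.
rewrite mul_eval_sum; apply: eq_bigr => x _; case: (coeff x g) => m.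
  exact: mul_evalMn.
apply: (mulrI (unitrX m.+1 (uM (psi x)))).
by rewrite -mul_evalMn NegzE mulrNz mul_evalN mul_evalMn divrr ?unitrX.
Qed.

End MultiplicativeEvaluation.

(** * Laurent series of characteristic classes *)

Section LaurentProducts.
Context (K : fieldType).

Lemma lpowE (v : int) (f : ps K) n :
  lpow (Laurent v f) n = Laurent (v *+ n) (f ^+ n : ps K).
Proof.
by elim: n => // n; rewrite /lpow iterS => ->; rewrite mulrS exprS.
Qed.

Lemma linvE (v : int) (f : ps K) : f \is a GRing.unit ->
  linv (Laurent v f) = Laurent (- v) (f^-1 : ps K).
Proof. by move=> uf; congr Laurent; apply: fps_inv_psE. Qed.

Lemma lpowzE (v : int) (f : ps K) (n : int) : f \is a GRing.unit ->
  lpowz (Laurent v f) n = Laurent (v *~ n) (f ^ n : ps K).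
Proof.
move=> uf; case: n => n; first exact: lpowE.
change (linv (lpow (Laurent v f) n.+1) = Laurent (v *~ Negz n) (f ^ Negz n)).
rewrite lpowE linvE ?unitrX //.
Qed.

Lemma big_laurent (I : Type) (r : seq I) (v : I -> int) (f : I -> ps K) :
  \big[@lmul K/lone K]_(x <- r) Laurent (v x) (f x) =
  Laurent (\sum_(x <- r) v x) (\prod_(x <- r) f x).
Proof.
by elim: r => [|x r IH]; rewrite ?big_nil // !big_cons IH.
Qed.

End LaurentProducts.

Section CharacterClasses.
Context (K : fieldType).
Hypothesis char0 : forall n, n.+1%:R != 0 :> K.

(** In characteristic 0 the series exp (c b) is the normalized solution of the
equation b f' = c b f. *)
Lemma exp_ode (c : K) (f : ps K) :
  f 0%N = 1 -> ps_theta f = psC c * (psX K * f) -> f = fps_exp c.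
Proof.
move=> f0 Df; apply/funext => n; elim: n => [|n IH]; first by rewrite f0 fps_exp0.
apply: (mulfI (char0 n)).
have -> : n.+1%:R * f n.+1 = ps_theta f n.+1 by [].
have -> : n.+1%:R * fps_exp c n.+1 = ps_theta (fps_exp c) n.+1 by [].
by rewrite ps_theta_exp // Df !psCM !psXMS IH.
Qed.

Lemma fps_expD (a b : K) : fps_exp (a + b) = (fps_exp a : ps K) * fps_exp b.
Proof.
apply/esym/exp_ode; first by rewrite psME0 !fps_exp0 mulr1.
by rewrite ps_thetaM !ps_theta_exp // raddfD; ring.
Qed.

Lemma fps_exp_0 : fps_exp (0 : K) = 1 :> ps K.
Proof.
apply/esym/exp_ode => //; by rewrite ps_theta1 raddf0 mul0r.
Qed.

Lemma fps_expMz (a : K) (z : int) : fps_exp (a *~ z) = (fps_exp a : ps K) ^ z.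
Proof.
have expMn n : fps_exp (a *+ n) = (fps_exp a : ps K) ^+ n.
  by elim: n => [|n IH]; rewrite ?fps_exp_0 // mulrS fps_expD IH exprS.
case: z => n; first exact: expMn.
apply: (mulrI (unitrX n.+1 (exp_unit a))).
rewrite -[_ ^ _]/((fps_exp a : ps K) ^- n.+1) divrr ?unitrX ?exp_unit //.
by rewrite -expMn -fps_expD NegzE mulrNz subrr fps_exp_0.
Qed.

Lemma fps_exp_lin_eval (X : zmodType) (c : {additive X -> K}) (g : vchar X) :
  fps_exp (c (lin_eval id g)) = mul_eval (fun x => fps_exp (c x) : ps K) g.
Proof.
rewrite (raddf_lin_eval c) /lin_eval /mul_eval; elim: (dom g) => [|x r IH].
  by rewrite !big_nil fps_exp_0.
by rewrite !big_cons fps_expD IH fps_expMz.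
Qed.

Lemma psC_unit (c : K) : (psC c \is a GRing.unit) = (c != 0).
Proof. by []. Qed.

Lemma psCV (c : K) : c != 0 -> (psC c)^-1 = psC c^-1.
Proof. by move=> c0; rewrite -[LHS]fmorphV. Qed.

Lemma ps_scale_unit (c : K) (f : ps K) :
  f \is a GRing.unit -> ps_scale c f \is a GRing.unit.
Proof. by rewrite !unit_psE /ps_scale mul1r. Qed.

Lemma ps_scaleXz (c : K) (f : ps K) (k : int) : f \is a GRing.unit ->
  ps_scale c (f ^ k) = ps_scale c f ^ k.
Proof. exact: (rmorphXz (ps_scale c)). Qed.

Lemma ps_scale0 (f : ps K) : ps_scale 0 f = psC (f 0%N).
Proof.
apply/funext => n; rewrite /ps_scale expr0n /psC.
by case: eqP => [->|]; rewrite ?mul1r ?mul0r.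
Qed.

Lemma l_one_minus_expNE (c : K) :
  l_one_minus_expN c = Laurent 1 (psC c * ps_scale c (todd_inv K) : ps K).
Proof.
congr Laurent; apply/funext => n; rewrite psCM /ps_scale /todd_inv /fps_exp.
by rewrite [(- c) ^+ _]exprNn [c ^+ n.+1]exprS; ring.
Qed.

Lemma lpowz_one_plus (c : K) (z : int) :
  lpowz (l_one_plus c) (- z) = Laurent 0 (ps_scale c (segre_ps K) ^ z : ps K).
Proof.
have -> : l_one_plus c = Laurent 0 (ps_scale c (fps_lin 1 1) : ps K).
  congr Laurent; apply/funext => -[|[|n]];
  by rewrite /ps_scale /fps_lin /= ?expr0 ?expr1 ?mulr1 ?mulr0.
rewrite lpowzE ?ps_scale_unit ?segre_inv0 // mul0rz; congr Laurent.
rewrite /segre_ps rmorphV ?segre_inv0 //.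
by rewrite exprz_inv.
Qed.

End CharacterClasses.

(** * The trivial weight in the reduced tangent space *)

Section Diagonal.
Context (X : zmodType) (t : X) (t_exp : {additive X -> int}).
Hypothesis t_exp_t : t_exp t = 1.

Lemma t_exp_mul (c : int) : t_exp (t *~ c) = c.
Proof. by rewrite raddfMz t_exp_t intz. Qed.

Lemma t_mul_inj : injective (fun c : int => t *~ c).
Proof. by move=> c d /(congr1 t_exp); rewrite !t_exp_mul. Qed.

Lemma t_mul_eq0 (c : int) : (t *~ c == 0) = (c == 0).
Proof. by rewrite -(inj_eq t_mul_inj) mulr0z. Qed.

Definition one_minus_t : vchar X := << 0 >> - << t >>.

(** On the torus t1 t2 = 1 the class 1 - t2 is the conjugate of 1 - t1. *)
Lemma koszul_norm Q : vmul (koszul t (- t)) (vmul (vbar Q) Q) =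
  vmul (vbar (vmul one_minus_t Q)) (vmul one_minus_t Q).
Proof.
rewrite vbarM /koszul -/one_minus_t [vmul one_minus_t (_ - _)]vmulC vmulACA.
by rewrite [vbar one_minus_t]raddfB /= !vbarU oppr0.
Qed.

Section Partition.
Context (n : nat).
Implicit Types rho : {ffun 'I_n -> 'I_n.+1}.

(** The number of diagonal boxes; for a partition it is the side of the Durfee
square. *)
Definition diag rho : nat := (\sum_(i < n) (i < rho i))%N.

Lemma sum_diag rho :
  (\sum_(i < n) \sum_(j < rho i) (i == j :> nat) = diag rho)%N.
Proof.
apply: eq_bigr => i _; case: ltnP => [lt|le].
  rewrite (bigD1 (Ordinal lt)) //= eqxx big1 // => j.
  by rewrite -val_eqE eq_sym => /negbTE /= ->.
by rewrite big1 // => j _; rewrite gtn_eqF // (leq_trans (ltn_ord j)).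
Qed.

Lemma QcharE rho : Qchar t (- t) rho =
  \sum_(i < n) \sum_(j < rho i) << t *~ (i%:Z - j%:Z) >>.
Proof.
apply: eq_bigr => i _; apply: eq_bigr => j _.
by rewrite mulrzBr -!pmulrn mulNrn opprK addrC.
Qed.

Lemma coeff0_Qchar rho : coeff 0 (Qchar t (- t) rho) = (diag rho)%:Z.
Proof.
rewrite QcharE raddf_sum -sum_diag (big_morph Posz PoszD (erefl 0%:Z)).
apply: eq_bigr => i _; rewrite raddf_sum (big_morph Posz PoszD (erefl 0%:Z)).
apply: eq_bigr => j _; rewrite /= coeffU1 t_mul_eq0 subr_eq0 eqz_nat.
by case: eqP.
Qed.

(** Apply [coeff0_norm_ge] to the sign which is 1 on the t-exponents <= 0 and -1
on the positive ones.  A box with content c (its t-exponent) contributes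
sgn c - sgn (c + 1) to (1 - t) Q, that is 2 when c = 0 and 0 otherwise. *)
Lemma coeff0_norm_Qchar rho : (diag rho)%:Z *+ 2 <=
  coeff 0 (vmul (koszul t (- t)) (vmul (vbar (Qchar t (- t) rho)) (Qchar t (- t) rho))).
Proof.
rewrite koszul_norm; pose sgn x : int := if t_exp x <= 0 then 1 else -1.
apply: le_trans (coeff0_norm_ge _ (_ : forall x, `|sgn x| <= 1)); last first.
  by move=> x; rewrite /sgn; case: ifP.
have lin_eval1 x : lin_eval sgn (vmul one_minus_t << x >>) = sgn x - sgn (t + x).
  by rewrite vmulBl !vmulUU add0r raddfB /= !lin_evalU.
rewrite -sum_diag (big_morph Posz PoszD (erefl 0%:Z)) -sumrMnl QcharE.
rewrite [vmul _ _]raddf_sum /= [lin_eval _ _]raddf_sum /=.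
apply: ler_sum => i _; rewrite (big_morph Posz PoszD (erefl 0%:Z)) -sumrMnl.
rewrite [vmul _ _]raddf_sum /= [lin_eval _ _]raddf_sum /=.
apply: ler_sum => j _; rewrite /= lin_eval1 /sgn [t_exp (t + _)]raddfD /=.
rewrite !t_exp_mul t_exp_t.
by case: eqP => ij; case: ifP => h1; case: ifP => h2 //; lia.
Qed.
End Partition.

(** All the characters that occur in [g] are powers of [t]. *)
Definition t_supported (g : vchar X) := forall x, x != t *~ t_exp x -> coeff x g = 0.

Lemma t_supportedB g h : t_supported g -> t_supported h -> t_supported (g - h).
Proof. by move=> sg sh x xt; rewrite coeffB sg // sh // subrr. Qed.

Lemma t_supportedU c : t_supported << t *~ c >>.
Proof.
move=> x xt; rewrite coeffU1 [_ == x](_ : _ = false) //.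
by apply: contraNF xt => /eqP <-; rewrite t_exp_mul.
Qed.

Lemma t_supported_sum I (r : seq I) (P : pred I) (F : I -> vchar X) :
  (forall i, P i -> t_supported (F i)) -> t_supported (\sum_(i <- r | P i) F i).
Proof.
by move=> sF x xt; rewrite raddf_sum big1 // => i Pi; apply: sF.
Qed.

Lemma t_supported_dom g x : t_supported g -> x \in dom g -> x = t *~ t_exp x.
Proof.
by move=> sg; rewrite mem_dom => cx; apply/eqP; apply: contraNT cx => /sg ->.
Qed.

Lemma t_supported_vmul g h : t_supported g -> t_supported h -> t_supported (vmul g h).
Proof.
move=> sg sh x xt; rewrite !raddf_sum big1_seq // => a /= /(t_supported_dom sg) ea.
rewrite raddf_sum big1_seq // => b /= /(t_supported_dom sh) eb.
rewrite coeffU; case: eqP => [xE|]; last by rewrite mulr0.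
by move: xt; rewrite -xE raddfD mulrzDr -ea -eb eqxx.
Qed.

Lemma t_supported_vbar g : t_supported g -> t_supported (vbar g).
Proof.
move=> sg x xt; rewrite !raddf_sum big1_seq // => a /= /(t_supported_dom sg) ea.
rewrite coeffU; case: eqP => [xE|]; last by rewrite mulr0.
by move: xt; rewrite -xE raddfN mulrNz -ea eqxx.
Qed.

Lemma t_supported_one_minus_t : t_supported one_minus_t.
Proof.
apply: t_supportedB; first by rewrite -(mulr0z t); apply: t_supportedU.
by rewrite -[t]mulr1z; apply: t_supportedU.
Qed.

Lemma t_supported_Qchar n (rho : {ffun 'I_n -> 'I_n.+1}) :
  t_supported (Qchar t (- t) rho).
Proof.
by rewrite QcharE; do 2![apply: t_supported_sum => ? _]; apply: t_supportedU.
Qed.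

Context (N : nat) (y : 'I_N -> X).
Hypothesis y_inj : injective y.
Hypothesis t_exp_y : forall k, t_exp (y k) = 0.

(** The blocks k <> l carry the weight y_l / y_k, which is no power of t, so they
do not contain the trivial weight.  A block k = l contributes d - 2 d at most,
where d is the number of diagonal boxes. *)
Lemma coeff0_Tred_le n (pi : part_tuple N n) :
  coeff 0 (Tred t (- t) y pi) <= 1 - (\sum_k diag (pi k))%:Z.
Proof.
rewrite /Tred coeffD coeffU1 eqxx addrC lerD2l /Tvir raddf_sum.
rewrite (big_morph Posz PoszD (erefl 0%:Z)) -sumrN; apply: ler_sum => k _.
rewrite raddf_sum (bigD1 k) //= big1 ?addr0 => [|l lk].
  rewrite coeff_vmulUr addNr subr0 coeffB coeff0_Qchar.
  have := coeff0_norm_Qchar (pi k); rewrite mulr2n => le2.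
  by move: le2; set c := coeff _ _; lia.
rewrite coeff_vmulUr; set x := _ - _.
have xE : x = y k - y l by rewrite /x sub0r opprD opprK.
have : t_supported (Qchar t (- t) (pi l) - vmul (koszul t (- t))
    (vmul (vbar (Qchar t (- t) (pi k))) (Qchar t (- t) (pi l)))).
  apply: t_supportedB; first exact: t_supported_Qchar.
  apply: t_supported_vmul; last by apply: t_supported_vmul;
    [apply: t_supported_vbar|]; apply: t_supported_Qchar.
  apply: t_supported_vmul; first exact: t_supported_one_minus_t.
  apply: t_supportedB; first by rewrite -(mulr0z t); apply: t_supportedU.
  by rewrite -[- t]mulrN1z; apply: t_supportedU.
apply; rewrite xE raddfB !t_exp_y subrr mulr0z subr_eq0 (inj_eq y_inj).
by rewrite eq_sym.
Qed.

End Diagonal.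

(** * Hooks *)

Lemma sum_ltn m l : (l <= m)%N -> (\sum_(i < m) (i < l) = l)%N.
Proof.
move=> lm; rewrite -[RHS]card_ord -sum1_card (big_ord_widen m (fun=> 1%N) lm).
rewrite [RHS]big_mkcond.
by apply: eq_bigr => i _; case: ltnP.
Qed.

Lemma antitone_bool_sum m (b : 'I_m -> nat) :
  (forall i j : 'I_m, (i <= j)%N -> (b j <= b i)%N) -> (forall i, b i <= 1)%N ->
  forall i, b i = (i < \sum_j b j)%N.
Proof.
move=> anti b1 i; have [bi|bi] := posnP (b i); last first.
  have -> : b i = 1%N by apply/eqP; rewrite eqn_leq b1.
  suff -> : (i < \sum_j b j)%N by [].
  rewrite -{1}(sum_ltn (ltn_ord i)); apply: leq_sum => j _.
  by case: ltnP => // ji; apply: leq_trans bi (anti _ _ ji).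
suff le : (\sum_j b j <= i)%N by rewrite bi ltnNge le.
rewrite -(sum_ltn (ltnW (ltn_ord i))); apply: leq_sum => j _.
by case: ltnP => // /anti; rewrite bi.
Qed.

Section Hooks.
Context (N m : nat).
Notation n := m.+1.
Implicit Types (l : 'I_n) (s : 'I_N * 'I_n) (pi : part_tuple N n).

(** The hook of size n and leg length l. *)
Definition hook_part l : {ffun 'I_n -> 'I_n.+1} :=
  [ffun i : 'I_n => if i == ord0 then inord (n - l)
                    else inord (i <= l)%N].

Definition empty_part : {ffun 'I_n -> 'I_n.+1} := [ffun=> ord0].

Definition hook s : part_tuple N n :=
  [ffun k => if k == s.1 then hook_part s.2 else empty_part].

Lemma hook_part0 l : hook_part l ord0 = (n - l)%N :> nat.
Proof. by rewrite ffunE eqxx inordK // ltnS leq_subr. Qed.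

Lemma hook_partS l (i : 'I_m) : hook_part l (fintype.lift ord0 i) = (i < l)%N :> nat.
Proof.
rewrite ffunE eq_sym (negbTE (neq_lift _ _)) inordK ?lift0 //.
by rewrite ltnS (leq_trans (leq_b1 _)).
Qed.

Lemma hook_inj : injective hook.
Proof.
move=> [k l] [k' l'] /ffunP eq_h.
have /ffunP/(_ ord0)/(congr1 val) := eq_h k; rewrite !ffunE /= eqxx.
case: eqP => [<-|_]; rewrite !hook_part0 ?ffunE /=; last by have := ltn_ord l; lia.
have := ltn_ord l; have := ltn_ord l' => ? ? ?.
by congr (_, _); apply/val_inj => /=; lia.
Qed.

Lemma hook_is_fixed_point s : is_fixed_point (hook s).
Proof.
apply/andP; split.
  apply/forallP => k; rewrite ffunE; case: ifP => _; apply/forallP => i;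
    apply/forallP => j; apply/implyP; last by rewrite !ffunE.
  case: (unliftP ord0 i) => [i'|] ->; case: (unliftP ord0 j) => [j'|] -> //.
  - by rewrite !hook_partS /= ltnS => le; case: (ltnP j') => // /(leq_ltn_trans le) ->.
  - by rewrite hook_partS hook_part0 (leq_trans (leq_b1 _)) // subn_gt0.
rewrite (bigD1 s.1) //= [X in (_ + X)%N]big1 => [|k ks].
  rewrite addn0 ffunE eqxx big_ord_recl hook_part0.
  under eq_bigr => i _ do rewrite hook_partS.
  have le : (s.2 <= m)%N by rewrite -ltnS.
  by rewrite sum_ltn // subnK // ltnW.
by rewrite ffunE (negbTE ks) big1 // => i _; rewrite ffunE.
Qed.

(** With a single diagonal box, all rows but the first have length at most 1; the
size n then forces the number of rows of length 1. *)
Lemma hook_of_partition (rho : {ffun 'I_n -> 'I_n.+1}) :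
  is_partition rho -> (\sum_(i < n) rho i = n)%N -> (diag rho <= 1)%N ->
  exists l, rho = hook_part l.
Proof.
move=> /forallP part sum_rho diag1.
have anti (i j : 'I_n) : (i <= j)%N -> (rho j <= rho i)%N.
  by move/forallP: (part i) => /(_ j) /implyP.
have rho0 : (0 < rho ord0)%N.
  rewrite lt0n; apply/eqP => r0; move: sum_rho; rewrite big1 // => i _.
  by apply/eqP; rewrite -leqn0 -r0 anti.
have l_lt : (n - rho ord0 < n)%N by rewrite ltn_subrL rho0.
exists (Ordinal l_lt).
have rho1 (i : 'I_m) : (rho (fintype.lift ord0 i) <= 1)%N.
  rewrite leqNgt; apply/negP => gt1.
  move: diag1; rewrite /diag big_ord_recl rho0 leqNgt => /negP; apply.
  have m0 : (0 < m)%N by apply: leq_ltn_trans (ltn_ord i).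
  rewrite (bigD1 (Ordinal m0)) //= (_ : (_ < rho (fintype.lift _ _)) = true)%N //.
  exact: leq_trans gt1 (anti _ _ _).
have sumS : (\sum_(i < m) rho (fintype.lift ord0 i) = n - rho ord0)%N.
  by move: sum_rho; rewrite big_ord_recl; lia.
apply/ffunP => i; apply/val_inj => /=.
case: (unliftP ord0 i) => [i'|] ->.
  rewrite hook_partS /= -sumS; apply: antitone_bool_sum rho1 i' => j k jk.
  exact: anti.
by rewrite hook_part0 /= subKn // -ltnS.
Qed.

(** A nonempty partition has at least one diagonal box, so only one slot can be
nonempty. *)
Lemma is_hook pi : is_fixed_point pi -> (\sum_k diag (pi k) <= 1)%N ->
  exists s, pi = hook s.
Proof.
move=> /andP[/forallP part /eqP sum_pi] diag1.
have anti k (i j : 'I_n) : (i <= j)%N -> (pi k j <= pi k i)%N.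
  by move/forallP: (part k) => /(_ i) /forallP /(_ j) /implyP.
have diag_gt0 k : pi k != empty_part -> (0 < diag (pi k))%N.
  rewrite lt0n; apply: contraNneq; rewrite /diag big_ord_recl => /eqP.
  rewrite addn_eq0 => /andP[+ _] => r0; apply/eqP/ffunP => i.
  apply/val_inj; rewrite ffunE /=; apply/eqP; rewrite -leqn0.
  by apply: (leq_trans (anti k ord0 i isT)); rewrite leqNgt -eqb0.
have [k hk] : exists k, pi k != empty_part.
  apply/existsP; rewrite -[X in is_true X]negbK negb_exists; apply/negP => /forallP h.
  move: sum_pi; rewrite big1 // => k _; rewrite big1 // => i _.
  by move: (h k); rewrite negbK => /eqP ->; rewrite ffunE.
have others k' : k' != k -> pi k' = empty_part.
  move=> kk; apply/eqP; apply: contraLR diag1 => hk'.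
  rewrite (bigD1 k) //= (bigD1 k') //= -ltnNge.
  by have := diag_gt0 _ hk; have := diag_gt0 _ hk'; lia.
have [l hl] : exists l, pi k = hook_part l.
  apply: hook_of_partition => //.
    rewrite -[RHS]sum_pi (bigD1 k) //= [X in (_ + X)%N]big1 ?addn0 // => k' kk.
    by rewrite big1 // => i _; rewrite others // ffunE.
  by apply: leq_trans diag1; rewrite (bigD1 k) //= leq_addr.
exists (k, l); apply/ffunP => k'; rewrite ffunE /=.
by case: eqP => [->|/eqP] //; apply: others.
Qed.

End Hooks.

Section HookCharacters.
Context (X : zmodType) (t : X) (t_exp : {additive X -> int}).
Hypothesis t_exp_t : t_exp t = 1.
Context (N m : nat) (y : 'I_N -> X).
Hypothesis y_inj : injective y.
Hypothesis t_exp_y : forall k, t_exp (y k) = 0.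
Notation n := m.+1.
Implicit Types (l : 'I_n) (s : 'I_N * 'I_n) (pi : part_tuple N n).

(** The classes of these characters are the points at which residues are
taken. *)
Definition hook_wt s : X := y s.1 + t *~ s.2.

Lemma hook_wt_inj : injective hook_wt.
Proof.
move=> [k l] [k' l'] eq_w.
have := congr1 t_exp eq_w.
rewrite !raddfD /= !t_exp_y !(t_exp_mul t_exp_t) !add0r => -[] /val_inj el.
by move: eq_w; rewrite /hook_wt el /= => /addIr /y_inj ->.
Qed.

(** The contents of the boxes of a hook of leg length l are the n consecutive
integers from l - n + 1 to l. *)
Lemma Qchar_hook l :
  Qchar t (- t) (hook_part l) = \sum_(i < n) << t *~ (l%:Z - i%:Z) >>.
Proof.
rewrite QcharE big_ord_recl hook_part0.
transitivity (\sum_(0 <= i < n) << t *~ (l%:Z - i%:Z) >> : vchar X);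
  last by rewrite big_mkord.
have ln : (l <= n)%N := ltnW (ltn_ord l).
rewrite (big_cat_nat (leq0n l) ln) /= addrC; congr (_ + _); last first.
  rewrite big_nat_rev /= big_mkord.
  rewrite (big_ord_widen m (fun i => << t *~ (l%:Z - (l - i.+1)%N%:Z) >>)) -1?ltnS //.
  rewrite [RHS]big_mkcond; apply: eq_bigr => i _; rewrite hook_partS.
  case: ltnP => il; last by rewrite big_ord0.
  by rewrite big_ord1 /= /bump /= subr0; congr << t *~ _ >>; lia.
rewrite -[X in index_iota X _]add0n big_addn big_mkord; apply: eq_bigr => j _.
by congr << t *~ _ >>; lia.
Qed.

Lemma Qchar_empty : Qchar t (- t) (@empty_part m) = 0.
Proof.
rewrite QcharE big1 // => i _; have r0 : @empty_part m i = ord0 by rewrite ffunE.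
by rewrite r0 big_ord0.
Qed.

Lemma one_minus_t_Qchar_hook l : vmul (one_minus_t t) (Qchar t (- t) (hook_part l)) =
  << t *~ (l%:Z - n%:Z + 1) >> - << t *~ (l%:Z + 1) >>.
Proof.
rewrite Qchar_hook raddf_sum.
pose f i : vchar X := << t *~ (l%:Z - i%:Z + 1) >>.
transitivity (\sum_(0 <= i < n) (f i.+1 - f i)).
  rewrite big_mkord; apply: eq_bigr => i _ /=.
  rewrite vmulBl !vmulUU add0r /f; congr (<< _ >> - << _ >>).
    by congr (t *~ _); lia.
  by rewrite [RHS]mulrzDr addrC.
by rewrite telescope_sumr // /f subr0.
Qed.

(** As (1 - t) Q is a difference of two characters whose quotient is t^n, its norm
is (1 - t^n) (1 - t^(-n)). *)
Lemma koszul_hook l :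
  let Q := Qchar t (- t) (hook_part l) in
  vmul (koszul t (- t)) (vmul (vbar Q) Q) =
  << 0 >> *+ 2 - << t *~ n%:Z >> - << t *~ (- n%:Z) >>.
Proof.
rewrite /= koszul_norm one_minus_t_Qchar_hook [vbar _]raddfB /= !vbarU.
rewrite vmulBl !vmulBr !vmulUU -!mulrNz -!mulrzDr !addNr mulr0z.
have -> : - (l%:Z - n%:Z + 1) + (l%:Z + 1) = n%:Z by lia.
have -> : - (l%:Z + 1) + (l%:Z - n%:Z + 1) = - n%:Z by lia.
by rewrite opprB mulr2n addrACA !addrA.
Qed.

Lemma Qchar_hook_slot s k : Qchar t (- t) (hook s k) =
  if k == s.1 then Qchar t (- t) (hook_part s.2) else 0.
Proof. by rewrite ffunE; case: eqP => // _; exact: Qchar_empty. Qed.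

(** The blocks (k, s.1) add up to the sum over all s' of w_s / w_s', and the term
s' = s cancels against the constant terms of the norm. *)
Lemma Tred_hook s : Tred t (- t) y (hook s) =
  << t *~ n%:Z >> + << t *~ (- n%:Z) >>
  + \sum_(s' | s' != s) << hook_wt s - hook_wt s' >>.
Proof.
rewrite /Tred /Tvir exchange_big (bigD1 s.1) //= [X in _ + X + << 0 >>]big1; last first.
  move=> l ls; rewrite big1 // => k _.
  by rewrite [Qchar _ _ (hook s l)]Qchar_hook_slot (negbTE ls) !raddf0 addr0 vmul0l.
rewrite addr0; set Q := Qchar t (- t) (hook s s.1).
have QE : Q = Qchar t (- t) (hook_part s.2) by rewrite /Q Qchar_hook_slot eqxx.
under eq_bigr => k _ do rewrite vmulBl.
rewrite sumrB [X in _ - X + << 0 >>](bigD1 s.1) //=.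
rewrite [X in _ - (_ + X) + << 0 >>]big1; last first.
  move=> k ks; rewrite Qchar_hook_slot (negbTE ks) [vbar 0]raddf0.
  by rewrite !vmul0l raddf0 vmul0l.
rewrite addr0 addNr [vmul _ << 0 >>]vmulC vmul0x -/Q QE koszul_hook -QE.
have -> : \sum_k vmul Q << - y k + y s.1 >> =
    << 0 >> + \sum_(s' | s' != s) << hook_wt s - hook_wt s' >>.
  transitivity (\sum_s' << hook_wt s - hook_wt s' >> : vchar X);
    last by rewrite (bigD1 s) //= subrr.
  rewrite -(pair_bigA _ (fun k i => << hook_wt s - hook_wt (k, i) >>)) /=.
  apply: eq_bigr => k _; rewrite QE Qchar_hook vmulC raddf_sum.
  apply: eq_bigr => i _ /=; rewrite vmulUU /hook_wt /= mulrzBr opprD; congr << _ >>.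
  by rewrite [RHS]addrACA [- y k + _]addrC.
move: << 0 >> << t *~ n%:Z >> << t *~ (- n%:Z) >> (\sum_(_ | _) _) => z a b S.
have -> : z + S - (z *+ 2 - a - b) + z = S + (z + z) + (b + a - (z + z)).
  by rewrite mulr2n !opprB addrAC [z + S]addrC -[S + z + z]addrA [b + (a - _)]addrA.
by rewrite addrACA subrr addr0 addrC [b + a]addrC.
Qed.

Lemma coeff0_Tred_hook s : coeff 0 (Tred t (- t) y (hook s)) = 0.
Proof.
rewrite Tred_hook !coeffD !coeffU1 !(t_mul_eq0 t_exp_t) oppr_eq0 !add0r raddf_sum.
rewrite big1 // => s' ss'; rewrite /= coeffU1 subr_eq0.
by rewrite (inj_eq hook_wt_inj) eq_sym (negbTE ss').
Qed.

Lemma taut_hook (alpha : vchar X) s : taut t (- t) y alpha (hook s) =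
  \sum_(i < n) vmul alpha << hook_wt s - t *~ i >>.
Proof.
rewrite /taut (bigD1 s.1) //= big1 ?addr0 => [|k ks]; last first.
  by rewrite Qchar_hook_slot (negbTE ks) raddf0.
rewrite Qchar_hook_slot eqxx -vmulA Qchar_hook [vmul << _ >> _]raddf_sum /= raddf_sum.
apply: eq_bigr => i _ /=; rewrite vmulUU /hook_wt mulrzBr addrA.
by [].
Qed.

(** A fixed point other than a hook has at least two diagonal boxes, so the trivial
weight has negative multiplicity there. *)
Lemma sum_fixed_points (V : zmodType) (G : part_tuple N n -> V) :
  \sum_(pi : part_tuple N n | is_fixed_point pi)
    (if coeff 0 (Tred t (- t) y pi) < 0 then 0 else G pi) =
  \sum_s G (hook s).
Proof.
under eq_bigr => pi _ do rewrite -if_neg.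
rewrite -big_mkcondr -(big_imset _ (in2W (@hook_inj N m))) /=.
apply: eq_bigl => pi; apply/andP/imsetP => [[fix_pi]|[s _ ->]]; last first.
  by rewrite hook_is_fixed_point coeff0_Tred_hook.
rewrite -leNgt => c0.
have [] := is_hook fix_pi; last by move=> s ->; exists s.
have := le_trans c0 (coeff0_Tred_le t_exp_t y_inj t_exp_y pi); lia.
Qed.

End HookCharacters.

(** * Closed forms of the reduced series *)

Section HookContributions.
Context (X : zmodType) (t : X) (t_exp : {additive X -> int}).
Hypothesis t_exp_t : t_exp t = 1.
Context (N m : nat) (y : 'I_N -> X).
Hypothesis y_inj : injective y.
Hypothesis t_exp_y : forall k, t_exp (y k) = 0.
Notation n := m.+1.
Context (K : fieldType) (c1 : {additive X -> K}).
Hypothesis char0 : forall n, n.+1%:R != 0 :> K.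
Hypothesis c1_inj : injective c1.
Context (M : nat).
Hypothesis card_slots : (N * n = M.+1)%N.
Implicit Types (s : 'I_N * 'I_n).
Context (alpha : vchar X).

Let I : finType := ('I_N * 'I_n)%type.
Let z (s : I) : K := c1 (hook_wt t y s).
Let lam : K := c1 t.

Let z_inj : injective z.
Proof. by move=> s s' /c1_inj /(hook_wt_inj t_exp_t y_inj t_exp_y). Qed.

Let card_index : #|I| = M.+1.
Proof. by rewrite card_prod !card_ord. Qed.

(** The weights of the tautological class at the hook s are the products of w_s by
the characters x t^(-i), with x running through alpha and i < n. *)
Definition shifts : seq ('I_n * X) := [seq (i, x) | i <- enum 'I_n, x <- dom alpha].
Definition mult (j : 'I_n * X) : int := coeff j.2 alpha.
Definition shift (j : 'I_n * X) : K := c1 (j.2 - t *~ j.1).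

Let T s := Tred t (- t) y (hook s).
Let den s : K := - (n%:R * lam) ^+ 2 * \prod_(s' | s' != s) (z s - z s').

Let c1_neq0 x : x != 0 -> c1 x != 0.
Proof. by move=> x0; rewrite -(raddf0 c1) (inj_eq c1_inj). Qed.

Let t_neq0 (c : int) : c != 0 -> t *~ c != 0.
Proof. by rewrite (t_mul_eq0 t_exp_t). Qed.

Let T_neq0 s x : x \in dom (T s) -> x != 0.
Proof.
rewrite mem_dom; apply: contraNneq => ->; apply/eqP.
exact: (coeff0_Tred_hook t_exp_t y_inj t_exp_y).
Qed.

Lemma rank_Tred_hook s : lin_eval (fun=> 1) (T s) = (M.+1 + 1)%N%:Z.
Proof.
rewrite /T (Tred_hook t_exp_t) !raddfD raddf_sum /= !lin_evalU.
under eq_bigr => s' _ do rewrite lin_evalU.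
rewrite sumr_const -card_index.
have -> : #|(fun s' => s' != s)| = M.
  by have := cardC1 (s : I); rewrite card_index /= => <-; apply: eq_card.
by rewrite -[1 *+ M]/(M%:R : int) natz; lia.
Qed.

(** The trivial weight, at which [phi] may fail to be invertible, occurs in the
individual summands of T^red but cancels in the total; [phi] is therefore
replaced by 1 there before the sum is split. *)
Lemma mul_eval_Tred_hook (phi : X -> ps K) s :
  (forall x, x != 0 -> phi x \is a GRing.unit) ->
  mul_eval phi (T s) = phi (t *~ n%:Z) * phi (t *~ (- n%:Z)) *
    \prod_(s' | s' != s) phi (hook_wt t y s - hook_wt t y s').
Proof.
move=> uphi; pose phi' x := if x == 0 then 1 else phi x.
have uphi' x : phi' x \is a GRing.unit.
  by rewrite /phi'; case: eqP => [_|/eqP/uphi]; rewrite ?unitr1.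
rewrite (_ : mul_eval phi (T s) = mul_eval phi' (T s)); last first.
  by apply: eq_mul_eval => x /T_neq0 x0; rewrite /phi' (negbTE x0).
rewrite /T (Tred_hook t_exp_t) !mul_evalD // mul_eval_sum // !mul_evalU //.
rewrite /phi' !(negbTE (t_neq0 _)) //; congr (_ * _).
apply: eq_bigr => s' ss'; rewrite mul_evalU // subr_eq0.
by rewrite (inj_eq (hook_wt_inj t_exp_t y_inj t_exp_y)) eq_sym (negbTE ss').
Qed.

Lemma mul_eval_taut_hook (f : ps K) s : f \is a GRing.unit ->
  mul_eval (fun x => ps_scale (c1 x) f) (taut t (- t) y alpha (hook s)) =
  \prod_(j <- shifts) ps_scale (z s + shift j) (f ^ mult j).
Proof.
move=> uf; have uphi x : ps_scale (c1 x) f \is a GRing.unit by apply: ps_scale_unit.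
rewrite (taut_hook t_exp_t) mul_eval_sum // /shifts big_allpairs_dep big_enum /=.
apply: eq_bigr => i _.
rewrite vmulE mul_eval_lin_eval //; apply: eq_bigr => x _; rewrite lin_evalU mul_evalU //.
rewrite /mult /shift (ps_scaleXz _ _ uf) addrCA (raddfD c1); reflexivity.
Qed.

Lemma big_lpowz_hook (phi : X -> ps K) s :
  (forall x, x != 0 -> phi x \is a GRing.unit) ->
  \big[@lmul K/lone K]_(x <- dom (T s))
    lpowz (Laurent 1 (phi x)) (coeff x (T s)) =
  Laurent (M.+1 + 1)%N%:Z (phi (t *~ n%:Z) * phi (t *~ (- n%:Z)) *
    \prod_(s' | s' != s) phi (hook_wt t y s - hook_wt t y s')).
Proof.
move=> uphi; rewrite -mul_eval_Tred_hook // -(rank_Tred_hook s) -big_laurent.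
apply: eq_big_seq => x /T_neq0 x0; exact: lpowzE (uphi x x0).
Qed.

Let c1_nt : c1 (t *~ n%:Z) = n%:R * lam.
Proof. by rewrite raddfMz -mulrzl. Qed.

Let c1_Nnt : c1 (t *~ (- n%:Z)) = - (n%:R * lam).
Proof. by rewrite mulrNz raddfN c1_nt. Qed.

Let psC_c1_unit x : x != 0 -> psC (c1 x) \is a GRing.unit.
Proof. by move=> x0; rewrite psC_unit c1_neq0. Qed.

Let prod_psC_c1 s :
  psC (c1 (t *~ n%:Z)) * psC (c1 (t *~ (- n%:Z))) *
    \prod_(s' | s' != s) psC (c1 (hook_wt t y s - hook_wt t y s')) = psC (den s).
Proof.
rewrite c1_nt c1_Nnt -rmorphM -rmorph_prod -rmorphM mulrN; congr psC.
by congr (_ * _); apply: eq_bigr => s' _; rewrite raddfB.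
Qed.

Let den_neq0 s : den s != 0.
Proof.
rewrite mulf_neq0 ?oppr_eq0 ?expf_neq0 //.
  by rewrite -c1_nt c1_neq0 // t_neq0.
by apply/prodf_neq0 => s' ss'; rewrite subr_eq0 (inj_eq z_inj) eq_sym.
Qed.

Lemma euler_hook s : euler c1 (T s) = Laurent (M.+1 + 1)%N%:Z (psC (den s)).
Proof.
rewrite -prod_psC_c1.
exact: (@big_lpowz_hook (fun x => psC (c1 x)) s psC_c1_unit).
Qed.

(** The Euler class of T^red has degree N n + 1, so the part of degree -1 of a
quotient by it is read off at b^(Nn). *)
Lemma lcoef_quotient (f g : ps K) : g \is a GRing.unit ->
  lcoef (lmul (Laurent 0 f) (linv (Laurent (M.+1 + 1)%N%:Z g))) (-1) =
  (f * g^-1) M.+1.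
Proof.
move=> ug; rewrite linvE //; set L := lmul _ _.
have eL : -1 - lval L = M.+1%:Z by rewrite /L /=; lia.
by rewrite /lcoef eL.
Qed.

Lemma segre_hook s :
  lcoef (lmul (segre c1 (taut t (- t) y alpha (hook s)))
              (linv (euler c1 (T s)))) (-1) =
  integrand z shifts mult shift 1 (segre_ps K) 1 (z s) M.+1 / den s.
Proof.
have -> : segre c1 (taut t (- t) y alpha (hook s)) =
    Laurent 0 (\prod_(j <- shifts) ps_scale (z s + shift j) (segre_ps K ^ mult j) : ps K).
  rewrite -mul_eval_taut_hook ?segre_unit // /segre.
  under eq_bigr => x _ do rewrite lpowz_one_plus.
  by rewrite big_laurent big1.
rewrite euler_hook lcoef_quotient ?psC_unit ?den_neq0 // psCV ?den_neq0 //.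
rewrite mulrC psCM mulrC /integrand mul1r [\prod_t _]big1 ?mulr1 // => s' _.
exact: rmorph1.
Qed.

(** The weights t1^n and t1^(-n) give the factor [e] of the integrand.  It has no
linear term because it is even in b. *)
Lemma verlinde_hook s :
  lcoef (lmul (ch_det c1 (taut t (- t) y alpha (hook s)))
              (linv (ch_Lambda_dual c1 (T s)))) (-1) =
  integrand z shifts mult shift
    (ps_scale (n%:R * lam) (todd_ps K) * ps_scale (- (n%:R * lam)) (todd_ps K))
    (exp_ps K) (todd_ps K) (z s) M.+1 / den s.
Proof.
have uT : todd_inv K \is a GRing.unit by rewrite -unitrV todd_unit.
have -> : ch_det c1 (taut t (- t) y alpha (hook s)) =
    Laurent 0 (\prod_(j <- shifts) ps_scale (z s + shift j) (exp_ps K ^ mult j) : ps K).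
  rewrite -mul_eval_taut_hook ?exp_unit //; set g := taut _ _ _ _ _.
  have e : fps_exp (c1 (lin_eval id g)) = mul_eval (fun x => ps_scale (c1 x) (exp_ps K)) g
      :> ps K.
    rewrite (fps_exp_lin_eval char0); apply: eq_mul_eval => x _.
    by rewrite ps_scale_exp.
  by rewrite -e.
pose phi x := psC (c1 x) * ps_scale (c1 x) (todd_inv K).
have uphi x : x != 0 -> phi x \is a GRing.unit.
  by move=> x0; rewrite unitrM psC_c1_unit ?ps_scale_unit.
have -> : ch_Lambda_dual c1 (T s) = Laurent (M.+1 + 1)%N%:Z
    (psC (den s) * (ps_scale (n%:R * lam) (todd_inv K) *
      ps_scale (- (n%:R * lam)) (todd_inv K) *
      \prod_s' ps_scale (z s - z s') (todd_inv K))).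
  rewrite /ch_Lambda_dual; under eq_bigr => x _ do rewrite l_one_minus_expNE.
  rewrite (big_lpowz_hook _ uphi) /phi big_split /=.
  apply: (congr1 (fun f : ps K => Laurent (M.+1 + 1)%N%:Z f)).
  rewrite -prod_psC_c1 c1_nt c1_Nnt [\prod_s' ps_scale _ _](bigD1 s) //= subrr ps_scale0.
  rewrite todd_inv0 rmorph1 mul1r.
  have -> : \prod_(s' | s' != s) ps_scale (c1 (hook_wt t y s - hook_wt t y s'))
      (todd_inv K) = \prod_(s' | s' != s) ps_scale (z s - z s') (todd_inv K).
    by apply: eq_bigr => s' _; rewrite raddfB.
  by ring.
rewrite lcoef_quotient; last first.
  rewrite !unitrM psC_unit den_neq0 !ps_scale_unit //=.
  by apply: rpred_prod => s' _; apply: ps_scale_unit.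
rewrite invrM ?psC_unit ?den_neq0 //; last first.
  rewrite !unitrM !ps_scale_unit //=.
  by apply: rpred_prod => s' _; apply: ps_scale_unit.
rewrite mulrA psCV ?den_neq0 // mulrC psCM mulrC.
apply: (congr1 (fun f : ps K => f M.+1 / den s)).
rewrite /integrand.
have scaleV c : ps_scale c (todd_ps K) = (ps_scale c (todd_inv K))^-1.
  exact: rmorphV.
have uS c : ps_scale c (todd_inv K) \is a GRing.unit by apply: ps_scale_unit.
under [\prod_t ps_scale _ (todd_ps K)]eq_bigr => t' _ do rewrite scaleV.
rewrite prodrV // !scaleV !invrM ?unitrM ?uS ?rpred_prod //.
by ring.
Qed.

Let rho : int := \sum_(j <- shifts) mult j.
Let A := \sum_(j <- shifts) shift j *~ mult j.
Let Z := \sum_s z s.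
Let d : int := lin_eval (fun=> 1) alpha.

Lemma rhoE : rho = d *+ n.
Proof.
rewrite /rho /shifts big_allpairs_dep big_enum /=.
transitivity (\sum_(i < n) d); last by rewrite sumr_const card_ord.
by apply: eq_bigr => i _; apply: eq_bigr => x _; rewrite /mult intz.
Qed.

(** The terms in lambda cancel: the hooks and the shifts run through the same
multiples of lambda, up to sign. *)
Lemma residue_factor : A + rho%:~R / M.+1%:R * Z =
  n%:R * (lin_eval c1 alpha + d%:~R / N%:R * \sum_k c1 (y k)).
Proof.
have N0 : N%:R != 0 :> K by case: N card_slots => // N' _.
pose S : K := \sum_(i < n) i%:R.
have AE : A = n%:R * lin_eval c1 alpha - d%:~R * (lam * S).
  rewrite /A /shifts big_allpairs_dep big_enum /=.
  transitivity (\sum_(i < n) (lin_eval c1 alpha - d%:~R * (lam * i%:R))).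
    apply: eq_bigr => i _; rewrite /lin_eval /d /lin_eval rmorph_sum mulr_suml -sumrB.
    apply: eq_bigr => x _; rewrite /shift /mult /= raddfB raddfMz -/lam /= intz.
    by rewrite mulrzBl -[_ *~ i%:Z]mulr_natr; congr (_ - _); rewrite mulrzl.
  by rewrite sumrB sumr_const card_ord -mulr_sumr -mulr_sumr mulr_natl.
have ZE : Z = n%:R * (\sum_k c1 (y k)) + N%:R * (lam * S).
  rewrite /Z -(pair_bigA _ (fun k i => z (k, i))) /=.
  transitivity (\sum_k (n%:R * c1 (y k) + lam * S)).
    apply: eq_bigr => k _; rewrite /z /hook_wt /=.
    under eq_bigr => i _ do rewrite raddfD raddfMz -/lam -[_ *~ i%:Z]mulr_natr.
    by rewrite big_split sumr_const card_ord mulr_natl -mulr_sumr.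
  by rewrite big_split sumr_const card_ord -mulr_sumr /= !mulr_natl.
rewrite AE ZE rhoE -card_slots natrM rmorphMn /= -[d%:~R *+ n]mulr_natl.
have := char0 m; move: (n%:R : K) (N%:R : K) N0 => n' N' N'0 n'0.
by field; rewrite N'0 n'0.
Qed.

Let denom : K := - (n%:R * lam) ^+ 2.

Let sum_hooks e f g : e 0%N = 1 -> e 1%N = 0 ->
  f \is a GRing.unit -> g \is a GRing.unit ->
  \sum_s integrand z shifts mult shift e f g (z s) M.+1 / den s =
  n%:R * (lin_eval c1 alpha + d%:~R / N%:R * \sum_k c1 (y k)) *
  (f ^ (d *+ n) * g ^+ M.+1 * ps_dlog f) M.+1 / denom.
Proof.
move=> e0 e1 uf ug; rewrite -residue_factor -rhoE.
have := residue_series z_inj card_index (char0 M) shifts mult shift e0 e1 uf ug.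
rewrite -/rho -/A -/Z => <-.
by rewrite mulr_suml; apply: eq_bigr => s _; rewrite /den invfM mulrA mulrAC.
Qed.

Lemma segre_red_closed : segre_red c1 t (- t) y alpha (-1) n =
  n%:R * (lin_eval c1 alpha + d%:~R / N%:R * \sum_k c1 (y k)) *
  (- segre_coef K (d *+ n) M) / denom.
Proof.
rewrite /segre_red /= (sum_fixed_points t_exp_t y_inj t_exp_y (fun pi =>
  lcoef (lmul (segre c1 (taut t (- t) y alpha pi))
              (linv (euler c1 (Tred t (- t) y pi)))) (-1))).
rewrite (eq_bigr _ (fun s _ => segre_hook s)).
rewrite sum_hooks ?segre_unit ?unitr1 //; congr (_ * _ / _).
rewrite expr1n mulr1 ps_dlog_segre mulrN psNE mulrCA psXMS /segre_coef.
by rewrite exprzDr ?segre_unit.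
Qed.

Lemma verlinde_red_closed : verlinde_red c1 t (- t) y alpha (-1) n =
  n%:R * (lin_eval c1 alpha + d%:~R / N%:R * \sum_k c1 (y k)) *
  verlinde_coef K (d *+ n) M / denom.
Proof.
rewrite /verlinde_red /= (sum_fixed_points t_exp_t y_inj t_exp_y (fun pi =>
  lcoef (lmul (ch_det c1 (taut t (- t) y alpha pi))
              (linv (ch_Lambda_dual c1 (Tred t (- t) y pi)))) (-1))).
rewrite (eq_bigr _ (fun s _ => verlinde_hook s)).
rewrite sum_hooks ?exp_unit ?todd_unit //; first last.
- rewrite psME 2!big_ord_recl big_ord0 /ps_scale todd_ps0 !expr0 !expr1.
  by rewrite /bump /=; ring.
- by rewrite psME0 /ps_scale todd_ps0 !mulr1.
by rewrite ps_dlog_exp_ps // [_ * psX K]mulrC psXMS.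
Qed.

End HookContributions.

(** * The torus and the comparison of the closed forms *)

Section Torus.
Context (N r : nat).

Lemma char0_eq_field n : n.+1%:R != 0 :> eq_field N r.
Proof.
rewrite -(rmorph_nat (@tofrac _)) tofrac_eq0.
by rewrite -mpolyC_nat mpolyC_eq0 pnatr_eq0.
Qed.

Lemma chern1_is_zmod_morphism : zmod_morphism (@chern1 N r).
Proof.
move=> x x'; rewrite /chern1 -sumrB; apply: eq_bigr => i _.
by rewrite !mxE mulrzBr.
Qed.
HB.instance Definition _ :=
  GRing.isZmodMorphism.Build (torus_char N r) (eq_field N r) (@chern1 N r)
    chern1_is_zmod_morphism.

Lemma chern1_inj : injective (@chern1 N r).
Proof.
apply: raddf_inj => x x0; apply/rowP => i; rewrite mxE.
move: x0; rewrite /= /chern1; under eq_bigr => j _ do rewrite -raddfMz.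
rewrite -raddf_sum => /eqP; rewrite tofrac_eq0 => /eqP.
move=> /(congr1 (mcoeff U_(i))); rewrite raddf0 raddf_sum (bigD1 i) //=.
rewrite big1 => [|j ji]; last by rewrite raddfMz /= mcoeffXU (negbTE ji) mul0rz.
rewrite addr0 raddfMz /= mcoeffXU eqxx => /eqP.
by rewrite intr_eq0 => /eqP ->.
Qed.

(** It separates the powers of t1 from the weights y_i and v_j. *)
Definition t1_exponent (x : torus_char N r) : int :=
  x 0 (lshift r (lshift N ord0)).

Lemma t1_exponent_is_zmod_morphism : zmod_morphism t1_exponent.
Proof. by move=> x x'; rewrite /t1_exponent !mxE. Qed.
HB.instance Definition _ :=
  GRing.isZmodMorphism.Build (torus_char N r) int t1_exponent
    t1_exponent_is_zmod_morphism.

Lemma t1_exponent_t1 : t1_exponent (wt_t1 N r) = 1.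
Proof. by rewrite /t1_exponent mxE !eqxx. Qed.

Lemma t1_exponent_y i : t1_exponent (@wt_y N r i) = 0.
Proof.
by rewrite /t1_exponent mxE eq_lshift eq_lrshift.
Qed.

Lemma t1_exponent_v j : t1_exponent (@wt_v N r j) = 0.
Proof. by rewrite /t1_exponent mxE eq_lrshift. Qed.

Lemma delta_row_inj n (i j : 'I_n) :
  delta_mx 0 i = delta_mx 0 j :> 'rV[int]_n -> i = j.
Proof.
move/rowP/(_ i); rewrite !mxE !eqxx /=; case: eqP => // ->.
Qed.

Lemma wt_y_inj : injective (@wt_y N r).
Proof. by move=> i j /delta_row_inj /lshift_inj /rshift_inj. Qed.

Lemma wt_v_inj : injective (@wt_v N r).
Proof. by move=> i j /delta_row_inj /rshift_inj. Qed.

End Torus.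

Lemma segre_red_empty (X : zmodType) (K : fieldType) (c1 : X -> K) t1 t2 (y : 'I_0 -> X)
    alpha d : segre_red c1 t1 t2 y alpha d =1 fun=> 0.
Proof.
case=> // n; rewrite /segre_red /= big_pred0 // => pi.
by apply/negbTE; rewrite negb_and big_ord0 orbT.
Qed.

Lemma verlinde_red_empty (X : zmodType) (K : fieldType) (c1 : X -> K) t1 t2
    (y : 'I_0 -> X) alpha d : verlinde_red c1 t1 t2 y alpha d =1 fun=> 0.
Proof.
case=> // n; rewrite /verlinde_red /= big_pred0 // => pi.
by apply/negbTE; rewrite negb_and big_ord0 orbT.
Qed.

(** Multiplied by p! q!, both sides become - (p + q + 1)!. *)
Lemma segre_coef_symmetric (K : fieldType) (p q : nat) :
  (forall n, n.+1%:R != 0 :> K) ->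
  (-1) ^+ p.+1 * q.+1%:R * segre_coef K q.+1 p =
  (-1) ^+ q.+1 * p.+1%:R * segre_coef K p.+1 q.
Proof.
move=> char0; have fact0 i : i`!%:R != 0 :> K.
  by case: i`! (fact_gt0 i) => // j _; apply: char0.
have sign2 i : (-1) ^+ i * (-1) ^+ i = 1 :> K by rewrite -exprMn mulrNN mulr1 expr1n.
have main i j : i`!%:R * j`!%:R * ((-1) ^+ i.+1 * j.+1%:R * segre_coef K j.+1 i) =
    - (i + j).+1`!%:R.
  have := segre_coef_fact K j.+1 i; rewrite addSn [(j + i)%N]addnC => eq_sc.
  transitivity (- (-1) ^+ i * (i`!%:R * j.+1`!%:R * segre_coef K j.+1 i)).
    by rewrite factS natrM exprS; ring.
  by rewrite eq_sc mulNr mulrA sign2 mul1r.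
apply: (mulfI (mulf_neq0 (fact0 p) (fact0 q))); rewrite main.
by rewrite [p`!%:R * _]mulrC main addnC.
Qed.

Lemma lin_eval_V_class N r (V : zmodType) (f : torus_char N r -> V) :
  lin_eval f (V_class N r) = \sum_j f (@wt_v N r j).
Proof. by rewrite raddf_sum; apply: eq_bigr => j _; rewrite /= lin_evalU. Qed.

Lemma lin_eval_E_class N r (V : zmodType) (f : torus_char N r -> V) :
  lin_eval f (E_class N r) = \sum_i f (@wt_y N r i).
Proof. by rewrite raddf_sum; apply: eq_bigr => i _; rewrite /= lin_evalU. Qed.

(** Both sides are multiples of N W + r Y: here W and Y are the sums of the classes
of the v_j and of the y_i, and N, r are the ranks. *)
Lemma exchange_identity (K : fieldType) (s1 s2 N r n W Y c1 c2 D : K) :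
  N != 0 -> r != 0 -> n != 0 ->
  s1 * (r * n) * c1 = s2 * (N * n) * c2 ->
  s1 * (n * (W + r / N * Y) * - c1 / D) = s2 * (n * (Y + N / r * W) * - c2 / D).
Proof.
move=> N0 r0 n0 eq_c; have {}eq_c : s1 * c1 = s2 * N * c2 / r.
  by apply: (mulIf (mulf_neq0 r0 n0)); rewrite mulrAC eq_c; field.
have -> : s1 * (n * (W + r / N * Y) * - c1 / D) =
    - (n * (W + r / N * Y) * (s1 * c1)) / D by ring.
rewrite eq_c [RHS]mulrA; congr (_ / _); field.
by rewrite N0 r0.
Qed.

Theorem corollary1p15 (N : nat) :
  (forall a b : nat,
     SredE (alpha_class N a b) (-1)
       =1 fps_scale ((-1) ^+ N) (VredE (alpha_class N a b) (-1)))
  /\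
  (forall r : nat,
     fps_scale ((-1) ^+ N) (SredE (V_class N r) (-1))
       =1 fps_scale ((-1) ^+ r) (SredV (E_class N r) (-1))).
Proof.
split=> [a b|r] [|m].
- by rewrite /fps_scale mulr0.
- rewrite /fps_scale /SredE /VredE; case: N => [|N].
    by rewrite segre_red_empty verlinde_red_empty mulr0.
  have card_slots : (N.+1 * m.+1 = (N.+1 * m.+1).-1.+1)%N by rewrite prednK ?muln_gt0.
  rewrite (segre_red_closed (@t1_exponent_t1 _ _) (@wt_y_inj _ _)
    (@t1_exponent_y _ _) (@char0_eq_field _ _) (@chern1_inj _ _) card_slots).
  rewrite (verlinde_red_closed (@t1_exponent_t1 _ _) (@wt_y_inj _ _)
    (@t1_exponent_y _ _) (@char0_eq_field _ _) (@chern1_inj _ _) card_slots).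
  rewrite segre_coef_verlinde; last exact: char0_eq_field.
  rewrite -exprM; have -> : (-1) ^+ (N.+1 * m.+1) =
      - (-1) ^+ (N.+1 * m.+1).-1 :> eq_field N.+1 (a + b).
    by rewrite {1}card_slots exprS mulN1r.
  by rewrite mulrN !mulNr mulrCA; congr (- _); apply: esym (mulrA _ _ _).
- by rewrite /fps_scale !mulr0.
rewrite /fps_scale /SredE /SredV; case: N r => [|N] [|r].
(* When N or r is 0, the series without slots vanishes termwise, and so does the
other one because the class that it evaluates is 0. *)
- by rewrite !segre_red_empty !mulr0.
- rewrite segre_red_empty mulr0.
  have card_slots : (r.+1 * m.+1 = (r.+1 * m.+1).-1.+1)%N by rewrite prednK ?muln_gt0.
  rewrite (segre_red_closed (@t1_exponent_t1 _ _) (@wt_v_inj _ _)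
    (@t1_exponent_v _ _) (@char0_eq_field _ _) (@chern1_inj _ _) card_slots).
  by rewrite /E_class big_ord0 !raddf0 !mul0r addr0 mulr0 !mul0r mulr0.
- rewrite segre_red_empty mulr0.
  have card_slots : (N.+1 * m.+1 = (N.+1 * m.+1).-1.+1)%N by rewrite prednK ?muln_gt0.
  rewrite (segre_red_closed (@t1_exponent_t1 _ _) (@wt_y_inj _ _)
    (@t1_exponent_y _ _) (@char0_eq_field _ _) (@chern1_inj _ _) card_slots).
  by rewrite /V_class big_ord0 !raddf0 !mul0r addr0 mulr0 !mul0r mulr0.
have [p pE] : exists p, (N.+1 * m.+1 = p.+1)%N.
  by exists (N.+1 * m.+1).-1; rewrite prednK ?muln_gt0.
have [q qE] : exists q, (r.+1 * m.+1 = q.+1)%N.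
  by exists (r.+1 * m.+1).-1; rewrite prednK ?muln_gt0.
rewrite (segre_red_closed (@t1_exponent_t1 _ _) (@wt_y_inj _ _)
  (@t1_exponent_y _ _) (@char0_eq_field _ _) (@chern1_inj _ _) pE).
rewrite (segre_red_closed (@t1_exponent_t1 _ _) (@wt_v_inj _ _)
  (@t1_exponent_v _ _) (@char0_eq_field _ _) (@chern1_inj _ _) qE).
rewrite -!exprM pE qE !lin_eval_V_class !lin_eval_E_class.
have rq : r.+1%:Z *+ m.+1 = q.+1%:Z by rewrite -qE; lia.
have Np : N.+1%:Z *+ m.+1 = p.+1%:Z by rewrite -pE; lia.
have := @segre_coef_symmetric _ p q (@char0_eq_field N.+1 r.+1).
rewrite !sumr_const !card_ord !natz rq Np -pE -qE !natrM.
have := char0_eq_field N.+1 r.+1; rewrite -!pmulrn => char0.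
by apply: exchange_identity; apply: char0.
Qed.
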